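(* Let $A$ be the twisted symmetric algebra of a finite group $G$ over the subalgebra $\bar{A}$, with $K$ as in the context. Let $\bar{\chi}\in\mathrm{Irr}(K\bar{A})$, with stabilizer $G_{\bar\chi}$ in $G$, and suppose that $\bar{\chi}$ is extended to a character $\tilde{\chi}\in\mathrm{Irr}(KA_{G_{\bar{\chi}}})$, i.e., $\mathrm{Res}_{K\bar{A}}^{KA_{G_{\bar{\chi}}}}(\tilde{\chi})=\bar{\chi}$. Set $$\chi:=\mathrm{Ind}_{KA_{G_{\bar{\chi}}}}^{KA}(\tilde{\chi})\quad\text{and}\quad \chi_\xi:=\mathrm{Ind}_{KA_{G_{\bar{\chi}}}}^{KA}(\tilde{\chi}\cdot\xi)\ \text{ for all }\xi\in\mathrm{Irr}(KG_{\bar{\chi}}).$$ Then: 1. The characters $(\chi_\xi)_{\xi\in\mathrm{Irr}(KG_{\bar{\chi}})}$ are distinct irreducible characters of $KA$. 2. We have $$\mathrm{Ind}_{K\bar{A}}^{KA}(\bar{\chi})=\sum_{\xi\in\mathrm{Irr}(KG_{\bar{\chi}})}\xi(1)\chi_\xi.$$ In particular, $m_{\chi_\xi,\bar{\chi}}=\xi(1)$ and $\chi_\xi(1)=|G:G_{\bar{\chi}}|\,\bar{\chi}(1)\,\xi(1)$. 3. For all $\xi\in\mathrm{Irr}(KG_{\bar{\chi}})$, we have $$s_{\chi_\xi}=\frac{|G_{\bar{\chi}}|}{\xi(1)}\,s_{\bar{\chi}}.$$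
   Context: Setting. $\mathcal{O}$ is a Noetherian integrally closed domain with field of fractions $F$; $A$ is an $\mathcal{O}$-algebra, free and finitely generated as an $\mathcal{O}$-module, with a symmetrizing form $t$ (an $\mathcal{O}$-linear map $t:A\to\mathcal{O}$ with $t(ab)=t(ba)$ such that $a\mapsto(x\mapsto t(ax))$ is an isomorphism $A\to\mathrm{Hom}_{\mathcal{O}}(A,\mathcal{O})$). A subalgebra $\bar A$ is a symmetric subalgebra if $\bar A$ is free of finite rank over $\mathcal{O}$, the restriction $\bar t$ of $t$ to $\bar A$ is a symmetrizing form on $\bar A$, and $A$ is free of finite rank as a left $\bar A$-module. $A$ is the twisted symmetric algebra of the finite group $G$ over $\bar A$ if $\bar A$ is a symmetric subalgebra of $A$ and there are $\mathcal{O}$-submodules $(A_g)_{g\in G}$ of $A$ with $A=\bigoplus_{g\in G}A_g$, $A_gA_h=A_{gh}$ for all $g,h\in G$, $A_1=\bar A$, and $t(A_g)=0$ for $g\neq 1$. For each $g$ there is a unit $a_g$ of $A$ lying in $A_g$ with $A_g=a_g\bar A=\bar A a_g$; these are fixed, with $a_1=1$. For a subgroup $S\le G$ put $A_S:=\bigoplus_{g\in S}A_g$. $K$ is a finite Galois extension of $F$ such that $KA:=K\otimes_{\mathcal{O}}A$ and $K\bar A$ are split semisimple, and all group algebras over $K$ considered are split semisimple. $\mathrm{Irr}$ denotes the set of irreducible characters. $G$ acts on $Z(K\bar A)$ by $g(z)=a_gza_g^{-1}$, hence on the block-idempotents (central primitive idempotents) $\bar e(\bar\chi)$ of $K\bar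 A$, $\bar\chi\in\mathrm{Irr}(K\bar A)$, and hence on $\mathrm{Irr}(K\bar A)$ by $\bar e(g(\bar\chi))=g(\bar e(\bar\chi))$; $G_{\bar\chi}$ is the stabilizer of $\bar\chi$. If $S\le G$, $X$ is a $KA_S$-module with structural morphism $\rho$ and character $\psi$, and $Y$ is a $KS$-module with structural morphism $\sigma$ and character $\xi$, then $\psi\cdot\xi$ is the character of the $KA_S$-module $X\otimes_KY$ on which $\bar a a_g$ acts as $\rho(\bar aa_g)\otimes\sigma(g)$ ($\bar a\in K\bar A$, $g\in S$). $m_{\chi,\bar\chi}$ is the multiplicity of $\bar\chi$ in $\mathrm{Res}^{KA}_{K\bar A}(\chi)$. Schur elements: for $\chi\in\mathrm{Irr}(KA)$, $s_\chi:=\omega_\chi(\chi^\vee)$, where $\chi^\vee\in Z(KA)$ is defined by $t(\chi^\vee a)=\chi(a)$ for all $a\in KA$ and $\omega_\chi:Z(KA)\to K$ is the central character of $\chi$; $s_{\bar\chi}$ is defined likewise with respect to $\bar t$.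
   Formalization: That the character of the stabilizer algebra restricts to χ̄ is taken as an isomorphism of modules rather than equality of K-valued characters; these agree in characteristic 0, and in characteristic p the statement with mere equality of K-valued characters fails. *)

(* Defs.v *)
From HB Require Import structures.
From mathcomp Require Import all_boot all_order all_fingroup all_algebra.
From mathcomp Require Import all_solvable all_field all_character.
From mathcomp Require Import boolp.
From mathcomp Require classical_sets.

Set Implicit Arguments.
Unset Strict Implicit.
Unset Printing Implicit Defensive.

Import GRing.Theory.
Import VectorInternalTheory.
Local Open Scope ring_scope.

(* An element satisfying P (unspecified but fixed), or x0 if there is none. *)
Notation the_elt x0 P := (@classical_sets.xget _ x0 P).

Section BaseRing.

Definition noetherian (R : comNzRingType) : Prop :=
  forall I : R -> Prop,
    I 0 -> (forall x y, I x -> I y -> I (x + y)) ->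
    (forall c x, I x -> I (c * x)) ->
  exists s : seq R, forall x,
    I x <-> exists c : 'I_(size s) -> R, x = \sum_i c i * s`_i.

Definition integrally_closed (O : idomainType) : Prop :=
  forall z : {fraction O}, integralOver (@tofrac O) z -> exists c, z = tofrac c.

Definition frac_emb (O : idomainType) (K : fieldExtType {fraction O}) :
    {rmorphism O -> K} :=
  GRing.in_alg K \o @tofrac O.

End BaseRing.

(* K (x)_O A for A free of finite rank over O : an element is the row of its  *)
(* K-coordinates on the O-basis of A underlying the isomorphism v2r of A with *)
(* 'rV[O]_(dim A), and the product is the K-bilinear extension of that of A.  *)
Definition scext (O : comNzRingType) (K : fieldType)
    (phi : {rmorphism O -> K}) (A : falgType O) : Type := 'rV[K]_(dim A).

Section ScalarExtension.

Variables (O : comNzRingType) (K : fieldType) (phi : {rmorphism O -> K}).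
Variable A : falgType O.
Local Notation KA := (scext phi A).

HB.instance Definition _ := Vector.copy KA 'rV[K]_(dim A).

Definition scext_basis (i : 'I_(dim A)) : A := r2v (delta_mx 0 i).

Definition scext_inj (x : A) : KA := map_mx phi (v2r x).

Definition scext_lmul_mx (x : A) : 'M[O]_(dim A) :=
  \matrix_i v2r (x * scext_basis i).

Definition scext_lmul (u : 'rV[K]_(dim A)) : 'M[K]_(dim A) :=
  \sum_i u 0 i *: map_mx phi (scext_lmul_mx (scext_basis i)).

Definition scext_mul (u v : KA) : KA := v *m scext_lmul u.

Definition scext_one : KA := scext_inj 1.

Lemma scext_basis_sum (x : A) : x = \sum_i (v2r x) 0 i *: scext_basis i.
Proof.
apply: (can_inj v2rK); rewrite linear_sum {1}[v2r x]row_sum_delta.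
by apply: eq_bigr => i _; rewrite linearZ /= r2vK.
Qed.

Lemma scext_lmul_mxE (x y : A) : v2r y *m scext_lmul_mx x = v2r (x * y).
Proof.
rewrite {2}[y]scext_basis_sum mulr_sumr linear_sum mulmx_sum_row.
by apply: eq_bigr => i _; rewrite rowK -scalerAr linearZ.
Qed.

Lemma scext_lmul_mx_linear : linear scext_lmul_mx.
Proof.
move=> c x y; apply/row_matrixP => i.
by rewrite linearP /= !rowK mulrDl -scalerAl linearP.
Qed.

Lemma scext_lmul_linear : linear scext_lmul.
Proof.
move=> c u v; rewrite /scext_lmul scaler_sumr -big_split; apply: eq_bigr => i _.
by rewrite !mxE scalerDl scalerA.
Qed.

HB.instance Definition _ :=
  GRing.isLinear.Build O A 'M[O]_(dim A) _ scext_lmul_mx scext_lmul_mx_linear.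
HB.instance Definition _ :=
  GRing.isLinear.Build K 'rV[K]_(dim A) 'M[K]_(dim A) _ scext_lmul
    scext_lmul_linear.

Lemma scext_lmul_inj (x : A) :
  scext_lmul (scext_inj x) = map_mx phi (scext_lmul_mx x).
Proof.
rewrite {2}[x]scext_basis_sum linear_sum map_mx_sum; apply: eq_bigr => i _.
by rewrite linearZ /= map_mxZ !mxE.
Qed.

Lemma scext_injM (x y : A) :
  scext_inj (x * y) = scext_mul (scext_inj x) (scext_inj y).
Proof.
by rewrite /scext_mul scext_lmul_inj /scext_inj -map_mxM scext_lmul_mxE.
Qed.

Lemma scext_inj_basis (i : 'I_(dim A)) :
  scext_inj (scext_basis i) = delta_mx 0 i.
Proof. by rewrite /scext_inj r2vK map_delta_mx. Qed.

Lemma scext_sum (u : KA) : u = \sum_i u 0 i *: scext_inj (scext_basis i).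
Proof.
rewrite {1}[u]row_sum_delta; apply: eq_bigr => i _.
by rewrite scext_inj_basis.
Qed.

Fact scext_mulDl : left_distributive scext_mul +%R.
Proof. by move=> u v w; rewrite /scext_mul linearD mulmxDr. Qed.

Fact scext_mulDr : right_distributive scext_mul +%R.
Proof. by move=> u v w; rewrite /scext_mul mulmxDl. Qed.

Fact scext_scaleAl c (u v : KA) : c *: scext_mul u v = scext_mul (c *: u) v.
Proof. by rewrite /scext_mul linearZ /= scalemxAr. Qed.

Fact scext_scaleAr c (u v : KA) : c *: scext_mul u v = scext_mul u (c *: v).
Proof. by rewrite /scext_mul scalemxAl. Qed.

Fact scext_mul0l u : scext_mul 0 u = 0.
Proof. by rewrite /scext_mul linear0 mulmx0. Qed.

Fact scext_mul0r u : scext_mul u 0 = 0.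
Proof. by rewrite /scext_mul mul0mx. Qed.

Lemma scext_mul_suml (I : Type) (r : seq I) (f : I -> KA) v :
  scext_mul (\sum_(i <- r) f i) v = \sum_(i <- r) scext_mul (f i) v.
Proof.
exact: (big_morph (scext_mul^~ v) (fun _ _ => scext_mulDl _ _ _) (scext_mul0l v)).
Qed.

Lemma scext_mul_sumr (I : Type) (r : seq I) (f : I -> KA) v :
  scext_mul v (\sum_(i <- r) f i) = \sum_(i <- r) scext_mul v (f i).
Proof.
exact: (big_morph (scext_mul v) (fun _ _ => scext_mulDr _ _ _) (scext_mul0r v)).
Qed.

Fact scext_mulA : associative scext_mul.
Proof.
move=> u v w; rewrite [u]scext_sum !scext_mul_suml; apply: eq_bigr => i _.
rewrite -!scext_scaleAl.
congr (_ *: _).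
rewrite [v]scext_sum !(scext_mul_suml, scext_mul_sumr); apply: eq_bigr => j _.
rewrite -!(scext_scaleAl, scext_scaleAr); congr (_ *: _).
rewrite [w]scext_sum !scext_mul_sumr; apply: eq_bigr => k _.
by rewrite -!scext_scaleAr -!scext_injM mulrA.
Qed.

Fact scext_mul1 : right_id scext_one scext_mul.
Proof.
move=> u; rewrite [u]scext_sum scext_mul_suml; apply: eq_bigr => i _.
by rewrite -scext_scaleAl -scext_injM mulr1.
Qed.

Fact scext_1mul : left_id scext_one scext_mul.
Proof.
move=> u; rewrite [u]scext_sum scext_mul_sumr; apply: eq_bigr => i _.
by rewrite -scext_scaleAr -scext_injM mul1r.
Qed.

Fact scext_one_neq0 : scext_one != 0.
Proof.
apply/eqP => one0.
have KA0 (u : KA) : u = 0 by rewrite -[u]scext_1mul one0 scext_mul0l.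
have nA : (v2r (1 : A)) != 0 by rewrite -(can_eq r2vK) linear0 v2rK oner_neq0.
have /existsP[i _] : [exists i, (v2r (1 : A)) 0 i != 0].
  apply: contraR nA; rewrite negb_exists => /forallP v0.
  by apply/eqP/rowP => i; rewrite mxE; apply/eqP/negPn.
move/rowP: (KA0 (delta_mx 0 i)) => /(_ i); rewrite !mxE !eqxx /=.
by move/eqP; rewrite oner_eq0.
Qed.

HB.instance Definition _ := GRing.Zmodule_isNzRing.Build KA
  scext_mulA scext_1mul scext_mul1 scext_mulDl scext_mulDr scext_one_neq0.
HB.instance Definition _ := GRing.Lmodule_isLalgebra.Build K KA scext_scaleAl.
HB.instance Definition _ := GRing.Lalgebra_isAlgebra.Build K KA scext_scaleAr.
HB.instance Definition _ := Algebra_isFalgebra.Build K KA.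

Definition scext_form (t : A -> O) (u : KA) : K :=
  \sum_i u 0 i * phi (t (scext_basis i)).

End ScalarExtension.

Section Span.

Variables (K : fieldType) (vT : vectType K).

(* The K-subspace spanned by a possibly infinite set of vectors. *)
Definition vspan (P : vT -> Prop) : {vspace vT} :=
  the_elt 0%VS (fun U : {vspace vT} =>
    (forall x, P x -> x \in U) /\
    (forall W : {vspace vT}, (forall x, P x -> x \in W) -> (U <= W)%VS)).

Lemma vspanP (P : vT -> Prop) :
  (forall x, P x -> x \in vspan P) /\
  (forall W : {vspace vT}, (forall x, P x -> x \in W) -> (vspan P <= W)%VS).
Proof.
pose Q (U : {vspace vT}) :=
  forall W : {vspace vT}, (forall x, P x -> x \in W) -> (U <= W)%VS.
suff step n (U : {vspace vT}) : Q U -> (\dim {:vT} - \dim U <= n)%N ->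
    exists V : {vspace vT}, (forall x, P x -> x \in V) /\ Q V.
  apply: (@classical_sets.xgetPex _ (0%VS : {vspace vT})
    (fun U : {vspace vT} => (forall x, P x -> x \in U) /\ Q U)).
  apply: (step (\dim {:vT} - \dim (0 : {vspace vT}))%N 0%VS) => // W _.
  exact: sub0v.
elim: n U => [|n IHn] U QU leU;
  have [PU | /existsNP[x /not_implyP[Px /negP Ux]]] :=
    pselect (forall x, P x -> x \in U); first by exists U.
- have UT : U = {:vT}%VS.
    by apply/eqP; rewrite eqEdim subvf /= -subn_eq0 -leqn0.
  by rewrite UT memvf in Ux.
- by exists U.
have ltU : (\dim U < \dim (U + <[x]>))%N.
  rewrite (ltn_leqif (dimv_leqif_sup (addvSl _ _))) subv_add subvv /=.
  by rewrite -memvE.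
apply: (IHn (U + <[x]>)%VS).
  by move=> W PW; rewrite subv_add QU //= -memvE PW.
have leT : (\dim (U + <[x]>) <= \dim {:vT})%N by rewrite dimvS ?subvf.
rewrite leq_subLR; rewrite leq_subLR in leU.
by apply: (leq_trans leU); rewrite -addSnnS leq_add2r.
Qed.

End Span.

(* A module over a K-algebra B, finite dimensional over K, is given by its    *)
(* structural morphism rho : B -> 'M_n, where rho b acts on columns 'cV_n.    *)
Section Modules.

Variables (K : fieldType) (B : falgType K).

Definition is_repr n (rho : B -> 'M[K]_n) : Prop :=
  [/\ linear rho, rho 1 = 1%:M & forall x y, rho (x * y) = rho x *m rho y].

Definition irreducible_repr n (rho : B -> 'M[K]_n) : Prop :=
  [/\ is_repr rho, (0 < n)%N &
      forall W : {vspace 'cV[K]_n},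
        (forall b v, v \in W -> rho b *m v \in W) -> W = 0%VS \/ W = fullv].

(* chi(1) as a natural number, which chi itself only determines as an element *)
(* of K.                                                                      *)
Definition repr_degree n (rho : B -> 'M[K]_n) : nat := n.

Definition repr_char n (rho : B -> 'M[K]_n) (b : B) : K := \tr (rho b).

(* In positive characteristic the K-valued character of a reducible module    *)
(* only determines multiplicities modulo the characteristic, so equality of   *)
(* characters of such modules is expressed as isomorphism of the modules.     *)
Definition repr_iso n1 (rho1 : B -> 'M[K]_n1) n2 (rho2 : B -> 'M[K]_n2) : Prop :=
  exists (P : 'M[K]_(n1, n2)) (Q : 'M[K]_(n2, n1)),
    [/\ P *m Q = 1%:M, Q *m P = 1%:M & forall b, rho1 b *m P = P *m rho2 b].

Definition dsum_repr (J : finType) (d : J -> nat)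
    (rho : forall j, B -> 'M[K]_(d j)) (b : B) :
    'M[K]_(\sum_(k < #|J|) d (enum_val k)) :=
  @mxdiag K #|J| (fun k => d (enum_val k)) (fun k => rho (enum_val k) b).

(* The number of simple summands isomorphic to sigma in a decomposition of    *)
(* rho as a direct sum of simple modules.                                     *)
Definition multiplicity n (rho : B -> 'M[K]_n) m (sigma : B -> 'M[K]_m) : nat :=
  the_elt 0%N (fun k : nat =>
    exists (J : finType) (d : J -> nat) (tau : forall j, B -> 'M[K]_(d j)),
      [/\ forall j, irreducible_repr (tau j), repr_iso rho (dsum_repr tau) &
          k = #|[pred j | `[< repr_iso (tau j) sigma >] ]| ]).

(* B is isomorphic to a finite product of matrix algebras over K, through the *)
(* morphism b |-> (rho j b)_j.                                                *)
Definition split_semisimple : Prop :=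
  exists (J : finType) (d : J -> nat) (rho : forall j, B -> 'M[K]_(d j)),
    (forall j, is_repr (rho j) /\ (0 < d j)%N) /\
    (forall M : forall j, 'M[K]_(d j), exists! b, forall j, rho j b = M j).

Definition in_center (z : B) : Prop := forall b, z * b = b * z.

Definition central_idempotent (e : B) : Prop := in_center e /\ e * e = e.

Definition central_primitive_idempotent (e : B) : Prop :=
  [/\ central_idempotent e, e != 0 &
      forall f, central_idempotent f -> e * f = f -> f = 0 \/ f = e].

(* For the split simple module rho, central elements act by scalars. *)
Definition central_char n (rho : B -> 'M[K]_n) (z : B) : K :=
  the_elt 0 (fun c : K => rho z = c%:M).

Definition block_idempotent n (rho : B -> 'M[K]_n) : B :=
  the_elt 0 (fun e : B =>
    central_primitive_idempotent e /\ central_char rho e = 1).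

Definition dual_element (t chi : B -> K) : B :=
  the_elt 0 (fun v : B => forall a, t (v * a) = chi a).

Definition schur_element (t : B -> K) n (rho : B -> 'M[K]_n) : K :=
  central_char rho (dual_element t (repr_char rho)).

End Modules.

Section Induction.

Variables (K : fieldType) (C B : falgType K) (f : C -> B).

Definition res_repr n (rho : B -> 'M[K]_n) : C -> 'M[K]_n := fun c => rho (f c).

Variables (n : nat) (rho : C -> 'M[K]_n).

(* B (x)_C X, where X is the C-module given by rho and B is a right C-module  *)
(* through f, is the quotient of B (x)_K X by the subspace spanned by the     *)
(* b f(c) (x) x - b (x) c x. A family (b_j)_j stands for                      *)
(* \sum_j b_j (x) e_j in B (x)_K X, with (e_j)_j the canonical basis of X,    *)
(* and the quotient is identified with a complement of the subspace.          *)
Let BX := {ffun 'I_n -> B}.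

Definition ptens (b : B) (x : 'cV[K]_n) : BX := [ffun j => x j 0 *: b].

Definition tens_rel : {vspace BX} :=
  vspan (fun u : BX => exists b c x,
    u = ptens (b * f c) x - ptens b (rho c *m x)).

Definition ind_space : {vspace BX} := (tens_rel^C)%VS.

Definition ind_repr (b : B) : 'M[K]_(\dim ind_space) :=
  \matrix_(i, j) coord (vbasis ind_space) i
    (daddv_pi ind_space tens_rel [ffun k => b * (vbasis ind_space)`_j k]).

End Induction.

Section OverO.

Variables (O : idomainType) (A : falgType O).
Implicit Types P Q : A -> Prop.

Definition submodule P : Prop :=
  P 0 /\ forall c x y, P x -> P y -> P (c *: x + y).

Definition subalgebra P : Prop :=
  [/\ submodule P, P 1 & forall x y, P x -> P y -> P (x * y)].

Definition free_finite_rank P : Prop :=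
  exists (n : nat) (b : 'I_n -> A), (forall i, P (b i)) /\
    forall x, P x -> exists! c : {ffun 'I_n -> O}, x = \sum_i c i *: b i.

Definition left_free_finite_rank P : Prop :=
  exists (n : nat) (b : 'I_n -> A), forall x,
    exists! c : {ffun 'I_n -> A}, (forall i, P (c i)) /\ x = \sum_i c i * b i.

(* The restriction of t to P is a symmetrizing form on P : it is a trace form *)
(* and P -> Hom_O(P, O), a |-> (x |-> t (a x)), is bijective.                 *)
Definition symmetrizing_form P (t : A -> O) : Prop :=
  (forall x y, P x -> P y -> t (x * y) = t (y * x)) /\
  (forall f : A -> O,
     (forall c x y, P x -> P y -> f (c *: x + y) = c * f x + f y) ->
   exists! a, P a /\ forall x, P x -> f x = t (a * x)).

Definition symmetric_subalgebra (t : A -> O) P : Prop :=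
  [/\ subalgebra P, free_finite_rank P, symmetrizing_form P t &
      left_free_finite_rank P].

Definition submodule_mul P Q (x : A) : Prop :=
  exists (n : nat) (p q : 'I_n -> A),
    [/\ forall i, P (p i), forall i, Q (q i) & x = \sum_i p i * q i].

Definition direct_decomposition (I : finType) (P_ : I -> A -> Prop) : Prop :=
  forall x, exists! c : {ffun I -> A}, (forall i, P_ i (c i)) /\ x = \sum_i c i.

Record twisted_symmetric_algebra (gT : finGroupType) (t : A -> O)
    (Abar : A -> Prop) (A_ : gT -> A -> Prop) : Prop := TwistedSymmetricAlgebra {
  tsa_symmetric : symmetric_subalgebra t Abar;
  tsa_submodule : forall g, submodule (A_ g);
  tsa_direct : direct_decomposition A_;
  tsa_mul : forall g h x, submodule_mul (A_ g) (A_ h) x <-> A_ (g * h)%g x;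
  tsa_one : forall x, A_ 1%g x <-> Abar x;
  tsa_form : forall g x, g != 1%g -> A_ g x -> t x = 0
}.

Definition graded_units (gT : finGroupType) (Abar : A -> Prop)
    (A_ : gT -> A -> Prop) (a : gT -> A) : Prop :=
  a 1%g = 1 /\ forall g,
    [/\ a g \is a GRing.unit, A_ g (a g),
        forall x, A_ g x <-> exists2 b, Abar b & x = a g * b &
        forall x, A_ g x <-> exists2 b, Abar b & x = b * a g].

Definition sub_sum (gT : finGroupType) (A_ : gT -> A -> Prop) (S : {set gT})
    (x : A) : Prop :=
  exists2 c : gT -> A, forall g, A_ g (c g) & x = \sum_(g in S) c g.

End OverO.

Section OverK.

Variables (O : idomainType) (K : fieldType) (phi : {rmorphism O -> K}).
Variable A : falgType O.
Local Notation KA := (scext phi A).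
Local Notation iota := (@scext_inj O K phi A).

Definition scext_span (P : A -> Prop) : {vspace KA} :=
  vspan (fun u : KA => exists2 x, P x & u = iota x).

(* KP, inside KA, for a subalgebra P of A, built as a generated subalgebra so *)
(* as to be a total function of P; it is just the K-span of P (scext_subE).   *)
Definition scext_sub (P : A -> Prop) : {aspace KA} := <<scext_span P>>%AS.

Lemma scext_subE P : subalgebra P -> scext_sub P = scext_span P :> {vspace KA}.
Proof.
move=> [_ P1 PM]; have [PU minU] :=
  vspanP (fun u : KA => exists2 x, P x & u = iota x).
apply/eqP; rewrite eqEsubv /= sub_agenv andbT; apply: agenv_sub_modl.
  by rewrite -memvE; apply: (PU); exists 1.
apply/prodvP => u v Uu Uv.
suff /subvP/(_ u Uu) : (scext_span P <= amulr v @^-1: scext_span P)%VS.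
  by rewrite -memv_preim lfunE.
apply: (minU) => _ [x Px ->]; rewrite -memv_preim lfunE /=.
suff /subvP/(_ v Uv) : (scext_span P <= amull (iota x) @^-1: scext_span P)%VS.
  by rewrite -memv_preim lfunE.
apply: minU => _ [y Py ->]; rewrite -memv_preim lfunE /=.
by apply: PU; exists (x * y); [apply: PM | rewrite scext_injM].
Qed.

Definition scext_sub_incl (P Q : A -> Prop) (x : subvs_of (scext_sub P)) :
    subvs_of (scext_sub Q) := vsproj (scext_sub Q) (vsval x).

Definition scext_sub_form (P : A -> Prop) (t : A -> O)
    (x : subvs_of (scext_sub P)) : K := scext_form t (vsval x).

Variables (gT : finGroupType) (A_ : gT -> A -> Prop) (a : gT -> A).

(* The projection onto KA_g along the other components (the sum is direct).   *)
Definition graded_proj (g : gT) : 'End(KA) :=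
  sumv_pi (\sum_(h : gT) scext_span (A_ h))%VS g.

(* The module X (x)_K Y, for rho and sigma affording X and Y : an element of  *)
(* KA_g acts as rho (x) sigma g, extended linearly to KA_S.                   *)
Definition tens_repr (S : {group gT}) n
    (rho : subvs_of (scext_sub (sub_sum A_ S)) -> 'M[K]_n)
    m (sigma : gT -> 'M[K]_m) (x : subvs_of (scext_sub (sub_sum A_ S))) :
    'M[K]_(n * m) :=
  \sum_(g in S) tprod (rho (vsproj _ (graded_proj g (vsval x)))) (sigma g).

(* g(chi) = chi for the action on Irr(K Abar) transported from the action     *)
(* e |-> a_g e a_g^-1 on block idempotents.                                   *)
Definition char_stab (Abar : A -> Prop) n
    (rho : subvs_of (scext_sub Abar) -> 'M[K]_n) : {set gT} :=
  [set g | iota (a g) * vsval (block_idempotent rho) * (iota (a g))^-1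
           == vsval (block_idempotent rho)].

End OverK.

Arguments scext_form {O K} phi {A} t u.
Arguments scext_sub_form {O K} phi {A} P t x.
Arguments scext_sub_incl {O K} phi {A} P Q x.

Definition group_split_semisimple (K : fieldType) (gT : finGroupType)
    (S : {group gT}) : Prop :=
  inhabited (mx_completely_reducible (regular_repr K S) 1%:M) /\
  group_splitting_field K S.

Notation scalar_ext K A := (scext (frac_emb K) A).
Notation scalar_ext_sub K P := (subvs_of (scext_sub (frac_emb K) P)).

(* Main.v *)
Require Import Defs.
From HB Require Import structures.
From mathcomp Require Import all_boot all_order all_fingroup all_algebra.
From mathcomp Require Import all_solvable all_field all_character.
From mathcomp Require Import boolp.
From mathcomp Require classical_sets.

Set Implicit Arguments.
Unset Strict Implicit.
Unset Printing Implicit Defensive.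

Import GRing.Theory.
Import VectorInternalTheory.
Local Open Scope ring_scope.

(** Write e for the block idempotent of the given character chibar of KAbar.
    It is central in KAbar and acts as 1 on a module of chibar. If g lies
    outside the stabilizer S, the conjugate of e by a_g is a different
    primitive central idempotent, hence e (KA_g) e = 0 (bar_block_sandwich).
    Let X afford the extension of chibar to KA_S, let Y afford xi, and
    decompose the module induced from X (x) Y as the sum of the
    a_r (x) X (x) Y over the cosets rS. Then e projects this module onto its
    summand 1 (x) X (x) Y.

    The argument rests on one density statement. Since KAbar acts on X through
    all matrices and each a_g is invertible, KA_S acts on X (x) Y through
    every M (x) y with y in the image of KS; by Schur's orthogonality
    relations, KA_S therefore maps onto the product over xi of the algebras
    End(X (x) Y) (twist_jointly_onto). The elements a_r c e a_s^-1, with c in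
    KA_S, then act as arbitrary blocks, so that KA maps onto the product over
    xi of the full matrix algebras of the induced modules
    (induced_jointly_onto). This gives at once that these modules are simple
    and that their characters are distinct.

    For the decomposition of the module induced from chibar, the maps b (x) x
    |-> b (x) (x (x) e_i), where e_i runs over a basis of Y, are jointly onto
    by density, and the dimensions agree because the squares of the degrees
    xi(1) sum to |S| (ind_bar_iso). The multiplicity of chibar in the
    restriction of an induced module is read off the rank of e, because e acts
    as 0 or 1 on each simple module of KAbar (multiplicity_rank).

    For the Schur elements, take c in KA_S acting as a matrix unit E (x) E' on
    X (x) Y for one xi, and as 0 for the others. The modules of the chi_xi are
    together faithful on KA e (induced_faithful), so the element dual to the
    character chi_xi multiplies c e by the scalar s_(chi_xi), which gives
    s_(chi_xi) t(c e) = chi_xi(c e) = 1. As t vanishes outside degree 1,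
    t(c e) = (xi(1) / |S|) t(u e), where u in KAbar acts on X as E and xi(1) /
    |S| is the coefficient at 1 of the element of KS acting as E'. In the same
    way s_chibar t(u e) = 1. All of this is valid in any characteristic: the
    order of S and the degrees xi(1) are nonzero in K because KS is split
    semisimple (card_group_neq0, irr_degree_neq0). *)

(** * Linear maps, direct sums of modules and induced modules *)

Section LinearPredicate.

Variables (R : pzRingType) (U V : lmodType R) (f : U -> V).
Hypothesis lin_f : linear f.

Lemma linD x y : f (x + y) = f x + f y.
Proof. by have := lin_f 1 x y; rewrite !scale1r. Qed.

Lemma lin0 : f 0 = 0.
Proof. by apply: (addIr (f 0)); rewrite -linD !add0r. Qed.

Lemma linZ k x : f (k *: x) = k *: f x.
Proof. by have := lin_f k x 0; rewrite lin0 !addr0. Qed.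

Lemma linB x y : f (x - y) = f x - f y.
Proof. by rewrite linD -!scaleN1r linZ. Qed.

Lemma lin_sum (I : Type) (r : seq I) (P : pred I) F :
  f (\sum_(i <- r | P i) F i) = \sum_(i <- r | P i) f (F i).
Proof. exact: (big_morph f linD lin0). Qed.

End LinearPredicate.

Section MatrixDecomposition.

Variable K : fieldType.

(** The row of the matrices T j and the column of the matrices P j are
    mutually inverse, so both have as many rows as columns. *)
Lemma direct_sum_dim (J : finType) N n (T : J -> 'M[K]_(N, n))
    (P : J -> 'M[K]_(n, N)) :
  \sum_j T j *m P j = 1%:M -> (forall i j, P i *m T j = (i == j)%:R%:M) ->
  N = (#|J| * n)%N.
Proof.
move=> TP PT.
pose X := \mxrow_(k < #|J|) T (enum_val k).
pose Y := \mxcol_(k < #|J|) P (enum_val k).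
have XY : X *m Y = 1%:M by rewrite mul_mxrow_mxcol -TP [RHS]big_enum_val.
have YX : Y *m X = 1%:M.
  rewrite mul_mxcol_mxrow -(@mxdiagZ _ _ (fun=> n) 1).
  apply: eq_mxblock => i j.
  rewrite PT (inj_eq enum_val_inj); case: eqP; rewrite ?conform_mx_id //.
  by rewrite raddf0.
transitivity (\sum_(k < #|J|) n)%N; last by rewrite sum_nat_const card_ord.
by apply/eqP; rewrite eqn_leq (mulmx1_min XY) (mulmx1_min YX).
Qed.

End MatrixDecomposition.

Lemma cvmx_ext (K : fieldType) m p (M M' : 'M[K]_(m, p)) :
  (forall x : 'cV_p, M *m x = M' *m x) -> M = M'.
Proof.
move=> eqM; apply/matrixP => i k.
by have /colP/(_ i) := eqM (delta_mx k 0); rewrite -!colE !mxE.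
Qed.

Lemma row_free_onto (K : fieldType) m n (M : 'M[K]_(m, n)) :
  (forall y : 'cV_m, exists v, M *m v = y) -> row_free M.
Proof.
move=> ontoM; apply: inj_row_free => w wM; apply/rowP => i; rewrite mxE.
have [v Mv] := ontoM (delta_mx i 0).
have : w *m (M *m v) = 0 by rewrite mulmxA wM mul0mx.
by rewrite Mv -colE => /matrixP/(_ 0 0); rewrite !mxE.
Qed.

Lemma row_full_of_inj (K : fieldType) m n (M : 'M[K]_(m, n)) :
  (forall v : 'cV_n, M *m v = 0 -> v = 0) -> row_full M.
Proof.
move=> injM; rewrite /row_full -mxrank_tr; apply: inj_row_free => v vM.
apply: trmx_inj; rewrite trmx0; apply: injM.
by apply: trmx_inj; rewrite trmx_mul trmxK vM trmx0.
Qed.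

Section IsoDirectSum.

Variables (K : fieldType) (B : falgType K) (N : nat) (rho : B -> 'M[K]_N).
Variables (J : finType) (d : J -> nat) (tau : forall j, B -> 'M[K]_(d j)).

(** The column of the matrices L j is onto, hence has independent rows; the
    equality of dimensions makes it invertible. *)
Lemma iso_dsum_surj (L : forall j, 'M[K]_(d j, N)) :
    (forall j b, L j *m rho b = tau j b *m L j) ->
    (forall y : forall j, 'cV[K]_(d j), exists v, forall j, L j *m v = y j) ->
    N = (\sum_j d j)%N ->
  repr_iso rho (dsum_repr tau).
Proof.
move=> interL surjL eqN.
pose M := \mxcol_(k < #|J|) L (enum_val k).
have interM b : M *m rho b = dsum_repr tau b *m M.
  rewrite /M /dsum_repr mul_mxdiag_mxcol mxcol_mul.
  by apply: eq_mxcol => k; rewrite interL.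
have eqNk : N = (\sum_(k < #|J|) d (enum_val k))%N.
  by rewrite eqN [LHS]big_enum_val.
have freeM : row_free M.
  apply: row_free_onto => y.
  have [v Lv] := surjL (fun j => conform_mx 0 (submxcol y (enum_rank j))).
  exists v; rewrite /M mxcol_mul -[RHS]submxcolK; apply: eq_mxcol => k.
  by rewrite Lv; case: _ / (esym (enum_valK k)); rewrite conform_mx_id.
have fullM : row_full M.
  by move/eqP: freeM; rewrite /row_full => ->; rewrite [X in _ == X]eqNk.
exists (pinvmx M), M; split.
- exact: mulVpmx.
- exact: mulmxVp.
move=> b; rewrite -[LHS]mul1mx -(mulVpmx fullM) -[LHS]mulmxA.
by rewrite [M *m _]mulmxA interM -[_ *m M *m _]mulmxA mulmxVp // mulmx1.
Qed.

Lemma iso_dsum_span (L : forall j, 'M[K]_(N, d j))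
    (R : forall j, 'M[K]_(d j, N)) :
    (forall j b, rho b *m L j = L j *m tau j b) ->
    \sum_j L j *m R j = 1%:M -> N = (\sum_j d j)%N ->
  repr_iso rho (dsum_repr tau).
Proof.
move=> interL LR eqN.
pose X := \mxrow_(k < #|J|) L (enum_val k).
pose Y := \mxcol_(k < #|J|) R (enum_val k).
have XY : X *m Y = 1%:M by rewrite mul_mxrow_mxcol -LR [RHS]big_enum_val.
have eqNk : N = (\sum_(k < #|J|) d (enum_val k))%N.
  by rewrite eqN [LHS]big_enum_val.
have YX : Y *m X = 1%:M by move: (X) (Y) XY; rewrite -eqNk => *; apply: mulmx1C.
exists X, Y; split=> // b.
by rewrite /X mul_mxrow mul_mxrow_mxdiag; apply: eq_mxrow => k; rewrite interL.
Qed.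

End IsoDirectSum.

Section InducedModule.

Variables (K : fieldType) (C B : falgType K) (f : C -> B).

(* A basis of B as a right C-module, with its coordinate functions. *)
Variables (J : finType) (w : J -> B) (cf : J -> B -> C).
Hypothesis lin_cf : forall j, linear (cf j).
Hypothesis cf_mul : forall j b c, cf j (b * f c) = cf j b * c.
Hypothesis cf_sum : forall b, b = \sum_j w j * f (cf j b).
Hypothesis cf_dual : forall i j, cf i (w j) = (i == j)%:R.

Variables (n : nat) (rho : C -> 'M[K]_n).
Hypothesis rho_repr : is_repr rho.

Local Notation BX := {ffun 'I_n -> B}.
Local Notation indV := (ind_space f rho).
Local Notation relV := (tens_rel f rho).
Local Notation N := (\dim indV).

Lemma ptens_linl x : linear (fun b : B => ptens b x : BX).
Proof.
by move=> k b c; apply/ffunP => j; rewrite !ffunE scalerDr !scalerA mulrC.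
Qed.

Lemma ptens_linr b : linear (fun x : 'cV[K]_n => ptens b x : BX).
Proof.
by move=> k x y; apply/ffunP => j; rewrite !ffunE !mxE scalerDl scalerA.
Qed.

Definition left_mul (b : B) (u : BX) : BX := [ffun k => b * u k].

Lemma left_mul_is_linear b : linear (left_mul b).
Proof.
by move=> k u v; apply/ffunP => j; rewrite !ffunE mulrDr scalerAr.
Qed.

HB.instance Definition _ b :=
  GRing.isLinear.Build K BX BX _ (left_mul b) (left_mul_is_linear b).

Lemma left_mul_tens b b' x : left_mul b (ptens b' x) = ptens (b * b') x.
Proof. by apply/ffunP => k; rewrite !ffunE scalerAr. Qed.

Lemma tens_relP b c x : ptens (b * f c) x - ptens b (rho c *m x) \in relV.
Proof. by apply: (vspanP _).1; exists b, c, x. Qed.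

(** A linear map out of the direct sum of n copies of B factors through the
    tensor product as soon as it is balanced. *)
Lemma tens_rel_min (vT : vectType K) (h : {linear BX -> vT}) :
    (forall b c x, h (ptens (b * f c) x) = h (ptens b (rho c *m x))) ->
  forall u, u \in relV -> h u = 0.
Proof.
move=> hrel u Ru.
suff /subvP/(_ u Ru) : (relV <= lker (linfun h))%VS.
  by rewrite memv_ker lfunE => /eqP.
apply: (vspanP _).2 => _ [b [c [x ->]]].
by rewrite memv_ker lfunE /= linearB /= hrel subrr.
Qed.

Lemma left_mul_rel b u : u \in relV -> left_mul b u \in relV.
Proof.
move=> Ru.
suff /subvP/(_ u Ru) : (relV <= linfun (left_mul b) @^-1: relV)%VS.
  by rewrite -memv_preim lfunE.
apply: (vspanP _).2 => _ [b' [c [x ->]]].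
by rewrite -memv_preim lfunE /= linearB /= !left_mul_tens mulrA tens_relP.
Qed.

(** The class of u in the quotient, in coordinates on the chosen complement of
    the relations; ind_vec is the section given by that complement. *)
Definition ind_coord (u : BX) : 'cV[K]_N :=
  \col_i coord (vbasis indV) i (daddv_pi indV relV u).

Lemma ind_coord_is_linear : linear ind_coord.
Proof. by move=> k u v; apply/colP => i; rewrite !mxE !linearP. Qed.

HB.instance Definition _ :=
  GRing.isLinear.Build K BX 'cV[K]_N _ ind_coord ind_coord_is_linear.

Lemma ind_cap : (indV :&: relV = 0)%VS.
Proof. by rewrite capvC capv_compl. Qed.

Lemma ind_add u : u = daddv_pi indV relV u + daddv_pi relV indV u.
Proof. by rewrite daddv_pi_add ?ind_cap // addvC addv_complf memvf. Qed.

Lemma ind_coord_rel u : u \in relV -> ind_coord u = 0.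
Proof.
move=> Ru; have := ind_add u.
rewrite (@daddv_pi_id _ _ relV) ?capv_compl // -{1}[u]add0r => /addIr piu.
by apply/colP => i; rewrite !mxE -piu linear0.
Qed.

Definition ind_vec (v : 'cV[K]_N) : BX := \sum_i v i 0 *: (vbasis indV)`_i.

Lemma ind_vec_coord u : ind_vec (ind_coord u) = daddv_pi indV relV u.
Proof.
rewrite [RHS](coord_vbasis (memv_pi _ _ _)).
by apply: eq_bigr => i _; rewrite mxE.
Qed.

Lemma ind_coord_vec v : ind_coord (ind_vec v) = v.
Proof.
apply/colP => i; rewrite mxE daddv_pi_id ?ind_cap //; last first.
  by apply: memv_suml => j _; rewrite memvZ // vbasis_mem // mem_nth
    ?size_tuple.
rewrite /ind_vec linear_sum (bigD1 i) //= big1 => [|j /negPf ji];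
  rewrite linearZ /= coord_free ?(basis_free (vbasisP _)) //.
  by rewrite eqxx mulr1 addr0.
by rewrite ji mulr0.
Qed.

(** The relations are stable under left multiplication, so replacing u by its
    representative in the complement changes neither side. *)
Lemma ind_repr_coord b u :
  ind_repr f rho b *m ind_coord u = ind_coord (left_mul b u).
Proof.
have -> : ind_coord (left_mul b u) =
    ind_coord (left_mul b (ind_vec (ind_coord u))).
  rewrite ind_vec_coord {1}[u]ind_add linearD /= linearD /=.
  by rewrite [X in _ + X]ind_coord_rel ?addr0 // left_mul_rel ?memv_pi.
apply/colP => i; rewrite mxE [RHS]mxE /ind_vec (lin_sum (left_mul_is_linear b)).
rewrite !linear_sum /=; apply: eq_bigr => j _;
  rewrite mxE mulrC (linZ (left_mul_is_linear b)) !linearZ /=;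
    congr (_ * coord _ _ _).
Qed.

(** The matrix of x |-> b (x) x. Together with the maps ind_proj it turns
    statements on the induced module into identities between matrices that
    refer neither to the quotient nor to its complement. *)
Definition ind_tens (b : B) : 'M[K]_(N, n) :=
  \matrix_(i, k) ind_coord (ptens b (delta_mx k 0)) i 0.

Lemma ind_tensE b x : ind_tens b *m x = ind_coord (ptens b x).
Proof.
have -> : x = \sum_k x k 0 *: delta_mx k 0.
  by rewrite {1}[x]matrix_sum_delta; apply: eq_bigr => k _; rewrite big_ord1.
rewrite mulmx_sumr (lin_sum (@ptens_linr b)) linear_sum; apply: eq_bigr => k _.
rewrite -scalemxAr (linZ (@ptens_linr b)) linearZ /=; congr (_ *: _).
by apply/colP => i; rewrite -colE !mxE.
Qed.

Lemma ind_tens_linear : linear ind_tens.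
Proof.
move=> k b c; apply: cvmx_ext => x; rewrite mulmxDl -scalemxAl !ind_tensE.
by rewrite (ptens_linl x) linearP.
Qed.

Lemma ind_tens_balanced b c : ind_tens (b * f c) = ind_tens b *m rho c.
Proof.
apply: cvmx_ext => x; rewrite -mulmxA !ind_tensE; apply/eqP.
by rewrite -subr_eq0 -linearB /= ind_coord_rel ?tens_relP.
Qed.

Lemma ind_repr_tens b b' : ind_repr f rho b *m ind_tens b' = ind_tens (b * b').
Proof.
apply: cvmx_ext => x.
by rewrite -mulmxA !ind_tensE ind_repr_coord left_mul_tens.
Qed.

Definition tens_proj j (u : BX) : 'cV[K]_n := \sum_k col k (rho (cf j (u k))).

Lemma tens_proj_is_linear j : linear (tens_proj j).
Proof.
have [lin_rho _ _] := rho_repr.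
move=> k u v; rewrite /tens_proj scaler_sumr -big_split; apply: eq_bigr => l _.
by rewrite !ffunE lin_cf lin_rho linearP.
Qed.

HB.instance Definition _ j :=
  GRing.isLinear.Build K BX 'cV[K]_n _ (tens_proj j) (tens_proj_is_linear j).

Lemma tens_proj_tens j b x : tens_proj j (ptens b x) = rho (cf j b) *m x.
Proof.
have [lin_rho _ _] := rho_repr.
rewrite {2}[x]matrix_sum_delta mulmx_sumr; apply: eq_bigr => k _.
rewrite big_ord1 ffunE (linZ (lin_cf j)) (linZ lin_rho) linearZ /=.
by rewrite -scalemxAr -colE.
Qed.

(** The j-th coordinate of a vector of the induced module, seen as the direct
    sum of the w j (x) X. *)
Definition ind_proj j : 'M[K]_(n, N) :=
  \matrix_(k, i) tens_proj j (ind_vec (delta_mx i 0)) k 0.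

Lemma ind_projE j v : ind_proj j *m v = tens_proj j (ind_vec v).
Proof.
apply/colP => k; rewrite mxE /ind_vec linear_sum /= summxE.
apply: eq_bigr => i _; rewrite linearZ /= [RHS]mxE mulrC mxE; congr (_ * _).
rewrite [X in tens_proj _ X](bigD1 i) //= big1 ?addr0 => [|l /negPf il].
  by rewrite mxE !eqxx scale1r.
by rewrite mxE il scale0r.
Qed.

(** The map b (x) x |-> (cf j b) x is balanced because cf j is right C-linear;
    hence it vanishes on the relations and can be computed on any
    representative. *)
Lemma ind_proj_tens j b : ind_proj j *m ind_tens b = rho (cf j b).
Proof.
have [_ _ mul_rho] := rho_repr.
apply: cvmx_ext => x; rewrite -mulmxA ind_tensE ind_projE ind_vec_coord.
rewrite -tens_proj_tens; set u := ptens b x.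
rewrite [in RHS](ind_add u) linearD.
rewrite [X in _ = _ + X](@tens_rel_min _ (tens_proj j)) ?addr0 ?memv_pi //.
by move=> b' c y /=; rewrite !tens_proj_tens cf_mul mul_rho mulmxA.
Qed.

(** Expanding b on the basis w and moving the coordinates across the tensor
    sign gives b (x) x = sum_j w j (x) (cf j b) x. *)
Lemma ind_tens_decomposition : \sum_j ind_tens (w j) *m ind_proj j = 1%:M.
Proof.
apply: cvmx_ext => v; rewrite mul1mx mulmx_suml.
have [u ->] : exists u, v = ind_coord u by exists (ind_vec v);
  rewrite ind_coord_vec.
have -> : u = \sum_k ptens (u k) (delta_mx k 0).
  apply/ffunP => k; rewrite sum_ffunE (bigD1 k) //= big1 => [|l /negPf kl].
    by rewrite ffunE mxE !eqxx scale1r addr0.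
  by rewrite ffunE mxE eq_sym kl scale0r.
rewrite linear_sum /=.
under eq_bigr => j _ do rewrite mulmx_sumr.
rewrite exchange_big; apply: eq_bigr => k _ /=.
rewrite -ind_tensE {2}[u k]cf_sum (lin_sum ind_tens_linear) mulmx_suml.
apply: eq_bigr => j _.
by rewrite -mulmxA [ind_proj j *m _]mulmxA ind_proj_tens ind_tens_balanced
  mulmxA.
Qed.

Lemma dim_ind_space : N = (#|J| * n)%N.
Proof.
have [lin_rho rho1 _] := rho_repr.
apply: (direct_sum_dim ind_tens_decomposition) => i j.
by rewrite ind_proj_tens cf_dual; case: eqP => _;
  rewrite ?rho1 ?(lin0 lin_rho) ?raddf0.
Qed.

Lemma ind_mx_ext (M M' : 'M[K]_N) :
  (forall j, M *m ind_tens (w j) = M' *m ind_tens (w j)) -> M = M'.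
Proof.
move=> eqM; rewrite -[M]mulmx1 -[M']mulmx1 -ind_tens_decomposition !mulmx_sumr.
by apply: eq_bigr => j _; rewrite !mulmxA eqM.
Qed.

Lemma ind_repr_is_repr : is_repr (ind_repr f rho).
Proof.
split=> [k x y| |x y]; apply: ind_mx_ext => j.
- rewrite mulmxDl -scalemxAl !ind_repr_tens mulrDl -scalerAl.
  exact: ind_tens_linear.
- by rewrite ind_repr_tens mul1r mul1mx.
- by rewrite -mulmxA !ind_repr_tens mulrA.
Qed.

End InducedModule.

(** * Kronecker products *)

Section TensorSlots.

Variable K : fieldType.

Lemma trow_entry n1 (A : 'rV[K]_n1) m2 n2 (B : 'M[K]_(m2, n2))
    (i : 'I_m2) (s : 'I_(n1 * n2)) (j : 'I_n1) (l : 'I_n2) :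
  s = (j * n2 + l)%N :> nat -> trow A B i s = A 0 j * B i l.
Proof.
elim: n1 A s j => [|n1 IHn] A s j; first by case: j.
move=> /= def_s; rewrite mxE; case: splitP => k def_k.
  have j0 : j = 0.
    apply/val_inj/eqP; rewrite /= -leqn0 leqNgt; apply/negP => j_gt0.
    have := ltn_ord k; rewrite -def_k def_s ltnNge.
    by rewrite (leq_trans (leq_pmull n2 j_gt0)) // leq_addr.
  have -> : k = l by apply/val_inj; rewrite /= -def_k def_s j0.
  by rewrite !mxE j0; congr (A _ _ * _); apply/val_inj.
have j_gt0 : (0 < j)%N.
  rewrite lt0n; apply/eqP => j0; have := ltn_ord l.
  by rewrite ltnNge; move: def_s; rewrite def_k j0 mul0n add0n => <-;
    rewrite leq_addr.
have lt_j : (j.-1 < n1)%N by rewrite -ltnS prednK.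
rewrite (IHn _ _ (Ordinal lt_j)) /=.
  by rewrite mxE; congr (A _ _ * _); apply/val_inj; rewrite /= add1n prednK.
apply/eqP; rewrite -(eqn_add2l n2) -def_k def_s addnA -mulSn prednK //.
Qed.

(** The row and column indices of a Kronecker product are pairs in
    lexicographic order. *)
Lemma tprod_entry m1 n1 (A : 'M[K]_(m1, n1)) m2 n2 (B : 'M[K]_(m2, n2))
    (r : 'I_(m1 * m2)) (s : 'I_(n1 * n2)) (i : 'I_m1) (j : 'I_n1) (k : 'I_m2)
      (l : 'I_n2) :
    r = (i * m2 + k)%N :> nat -> s = (j * n2 + l)%N :> nat ->
  tprod A B r s = A i j * B k l.
Proof.
move=> + def_s; elim: m1 A r i => [|m1 IHm] A r i; first by case: i.
move=> /= def_r; rewrite mxE; case: splitP => t def_t.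
  have i0 : i = 0.
    apply/val_inj/eqP; rewrite /= -leqn0 leqNgt; apply/negP => i_gt0.
    have := ltn_ord t; rewrite -def_t def_r ltnNge.
    by rewrite (leq_trans (leq_pmull m2 i_gt0)) // leq_addr.
  have -> : t = k by apply/val_inj; rewrite /= -def_t def_r i0.
  rewrite (trow_entry _ _ _ def_s) mxE i0; congr (A _ _ * _); exact/val_inj.
have i_gt0 : (0 < i)%N.
  rewrite lt0n; apply/eqP => i0; have := ltn_ord k.
  by rewrite ltnNge; move: def_r; rewrite def_t i0 mul0n add0n => <-;
    rewrite leq_addr.
have lt_i : (i.-1 < m1)%N by rewrite -ltnS prednK.
rewrite (IHm _ _ (Ordinal lt_i)) /=.
  by rewrite mxE; congr (A _ _ * _); apply/val_inj; rewrite /= add1n prednK.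
by apply/eqP; rewrite -(eqn_add2l m2) -def_t def_r addnA -mulSn prednK.
Qed.

(** The embedding x |-> x (x) e_k of the first tensor factor. The m embeddings
    split the tensor product into copies of that factor, and Kronecker
    products are handled below only through them. *)
Definition slot n m (k : 'I_m) : 'M[K]_(n * m, n) :=
  \matrix_(r, c) ((r %/ m == c)%N && (r %% m == k)%N)%:R.

Variables n m : nat.
Implicit Types k l : 'I_m.

Lemma row_index_divP (r : 'I_(n * m)) :
  exists i : 'I_n, exists k : 'I_m, r = (i * m + k)%N :> nat.
Proof.
have m_gt0 : (0 < m)%N by case: (m) r => // -[r]; rewrite muln0.
have lt_d : (r %/ m < n)%N by rewrite ltn_divLR.
exists (Ordinal lt_d), (Ordinal (ltn_pmod r m_gt0)); exact: divn_eq.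
Qed.

Lemma pair_indexP (i : 'I_n) (k : 'I_m) : (i * m + k < n * m)%N.
Proof.
apply: (@leq_trans (i.+1 * m)%N); last by rewrite leq_mul2r ltn_ord orbT.
by rewrite mulSn addnC ltn_add2r.
Qed.

Lemma slot_entry (r : 'I_(n * m)) (i c : 'I_n) k l :
  r = (i * m + k)%N :> nat -> slot n l r c = ((i == c) && (k == l))%:R.
Proof.
move=> def_r; have m_gt0 : (0 < m)%N by apply: leq_ltn_trans (ltn_ord k).
by rewrite mxE def_r divnMDl // divn_small // addn0 modnMDl modn_small.
Qed.

Lemma slot_dual k l : (slot n k)^T *m slot n l = (k == l)%:R%:M.
Proof.
apply/matrixP => i j; rewrite !mxE.
rewrite (bigD1 (Ordinal (pair_indexP i k))) //= big1 => [|r ne_r].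
  rewrite mxE !(@slot_entry _ i _ k) // !eqxx mul1r addr0.
  by case: (i == j); case: (k == l).
have [i' [k' def_r]] := row_index_divP r.
rewrite mxE !(slot_entry _ _ def_r).
have [i'i|] := eqVneq i' i; last by rewrite mul0r.
have [k'k|] := eqVneq k' k; last by rewrite mul0r.
by case/eqP: ne_r; apply/val_inj; rewrite /= def_r i'i k'k.
Qed.

Lemma slot_sum : \sum_(k < m) slot n k *m (slot n k)^T = 1%:M.
Proof.
apply/matrixP => r s; rewrite summxE mxE.
have [i [k def_r]] := row_index_divP r; have [j [l def_s]] := row_index_divP s.
rewrite (bigD1 k) //= big1 ?addr0 => [|k' /negPf k'k].
  rewrite mxE (bigD1 i) //= big1 ?addr0 => [|i' /negPf i'i].
    rewrite (slot_entry _ _ def_r) mxE (slot_entry _ _ def_s) !eqxx mul1r.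
    congr (_ %:R); congr nat_of_bool; apply/andP/eqP => [[/eqP ji /eqP lk]|rs].
      by apply/val_inj; rewrite /= def_r def_s ji lk.
    have m_gt0 : (0 < m)%N by apply: leq_ltn_trans (ltn_ord k).
    move: def_s; rewrite -rs def_r => eq_ij; split; apply/eqP/val_inj => /=.
      have /(congr1 (divn^~ m)) := eq_ij.
      by rewrite !divnMDl // !divn_small // !addn0.
    by have /(congr1 (modn^~ m)) := eq_ij; rewrite !modnMDl !modn_small.
  by rewrite (slot_entry _ _ def_r) eq_sym i'i mul0r.
rewrite mxE big1 // => i' _.
by rewrite (slot_entry _ _ def_r) [k == _]eq_sym k'k andbF mul0r.
Qed.

Lemma tprod_slot_sum (A : 'M[K]_n) (B : 'M[K]_m) :
  tprod A B = \sum_(k < m) \sum_(l < m) B k l *: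
    (slot n k *m A *m (slot n l)^T).
Proof.
apply/matrixP => r s; rewrite summxE.
have [i [k def_r]] := row_index_divP r; have [j [l def_s]] := row_index_divP s.
rewrite (tprod_entry _ _ def_r def_s).
have slotA k' l' : (slot n k' *m A *m (slot n l')^T) r s =
    A i j * ((k == k') && (l == l'))%:R.
  rewrite mxE (bigD1 j) //= big1 ?addr0 => [|j' /negPf j'j].
    rewrite [(slot n l')^T _ _]mxE (slot_entry _ _ def_s) mxE.
    rewrite (bigD1 i) //= big1 ?addr0 => [|i' /negPf i'i].
      rewrite (slot_entry _ _ def_r) !eqxx /=.
      by case: (k == k'); case: (l == l');
        rewrite /= ?mul1r ?mulr1 ?mul0r ?mulr0.
    by rewrite (slot_entry _ _ def_r) eq_sym i'i mul0r.
  by rewrite [X in _ * X]mxE (slot_entry _ _ def_s) eq_sym j'j mulr0.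
rewrite (bigD1 k) //= summxE (bigD1 l) //= mxE slotA !eqxx mulr1 mulrC.
rewrite [X in _ + X + _]big1 => [|l' /negPf ll]; last first.
  by rewrite mxE slotA [l == _]eq_sym ll andbF !mulr0.
rewrite big1 ?addr0 // => k' /negPf kk; rewrite summxE big1 // => l' _.
by rewrite mxE slotA [k == _]eq_sym kk !mulr0.
Qed.

Lemma tprod_slot (A : 'M[K]_n) (B : 'M[K]_m) l :
  tprod A B *m slot n l = \sum_k B k l *: (slot n k *m A).
Proof.
rewrite tprod_slot_sum mulmx_suml; apply: eq_bigr => k _.
rewrite mulmx_suml (bigD1 l) //= big1 ?addr0 => [|l' /negPf ll].
  by rewrite -scalemxAl -mulmxA slot_dual eqxx mulmx1.
by rewrite -scalemxAl -mulmxA slot_dual ll raddf0 mulmx0 scaler0.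
Qed.

Lemma tprod_span (M : 'M[K]_(n * m)) :
  M = \sum_(k < m) \sum_(l < m) tprod ((slot n k)^T *m M *m slot n l)
    (delta_mx k l).
Proof.
rewrite -{1}[M]mul1mx -{1}[M]mulmx1 -!{1}slot_sum mulmx_suml.
apply: eq_bigr => k _; rewrite !mulmx_sumr; apply: eq_bigr => l _.
rewrite tprod_slot_sum (bigD1 k) //= (bigD1 l) //= mxE !eqxx scale1r.
rewrite [X in _ + X + _]big1 => [|l' /negPf ll]; last first.
  by rewrite mxE ll andbF scale0r.
rewrite big1 ?addr0 ?mulmxA // => k' /negPf kk; rewrite big1 // => l' _.
by rewrite mxE kk scale0r.
Qed.

Lemma tprodDl (A A' : 'M[K]_n) (B : 'M[K]_m) :
  tprod (A + A') B = tprod A B + tprod A' B.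
Proof.
rewrite !tprod_slot_sum -big_split; apply: eq_bigr => k _ /=.
rewrite -big_split; apply: eq_bigr => l _ /=.
by rewrite mulmxDr mulmxDl scalerDr.
Qed.

Lemma tprodZl c (A : 'M[K]_n) (B : 'M[K]_m) : tprod (c *: A) B = c *: tprod A B.
Proof.
rewrite !tprod_slot_sum scaler_sumr; apply: eq_bigr => k _ /=.
rewrite scaler_sumr; apply: eq_bigr => l _ /=.
by rewrite -scalemxAr -scalemxAl !scalerA mulrC.
Qed.

Lemma tprodDr (A : 'M[K]_n) (B B' : 'M[K]_m) :
  tprod A (B + B') = tprod A B + tprod A B'.
Proof.
rewrite !tprod_slot_sum -big_split; apply: eq_bigr => k _ /=.
by rewrite -big_split; apply: eq_bigr => l _ /=; rewrite mxE scalerDl.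
Qed.

Lemma tprodZr c (A : 'M[K]_n) (B : 'M[K]_m) : tprod A (c *: B) = c *: tprod A B.
Proof.
rewrite !tprod_slot_sum scaler_sumr; apply: eq_bigr => k _ /=.
by rewrite scaler_sumr; apply: eq_bigr => l _ /=; rewrite mxE scalerA.
Qed.

End TensorSlots.

(** * Split semisimple algebras and block idempotents *)

Section Irreducible.

Variables (K : fieldType) (B : falgType K) (n : nat) (X : B -> 'M[K]_n).
Hypothesis irrX : irreducible_repr X.

Let reprX : is_repr X. Proof. by have [] := irrX. Qed.

(** The image of M is a nonzero submodule. *)
Lemma irr_invariant_onto m (M : 'M[K]_(n, m)) :
    (forall b, exists Mb : 'M_m, X b *m M = M *m Mb) -> M != 0 ->
  forall y : 'cV_n, exists v : 'cV_m, M *m v = y.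
Proof.
move=> invM M0.
have [_ _ irr] := irrX.
pose W := limg (linfun (@mulmx _ n m 1 M)).
have inW y : reflect (exists v : 'cV_m, M *m v = y) (y \in W).
  apply: (iffP memv_imgP) => [[v _ ->]|[v <-]]; exists v;
    rewrite ?memvf ?lfunE //.
have [|W0|WT] := irr W.
- move=> b v /inW[u <-]; have [Mb E] := invM b.
  by apply/inW; exists (Mb *m u); rewrite !mulmxA E.
- case/eqP: M0; apply: cvmx_ext => x; rewrite mul0mx; apply/eqP.
  by rewrite -memv0 -W0; apply/inW; exists x.
by move=> y; apply/inW; rewrite WT memvf.
Qed.

(** Schur's lemma for idempotents: the image of X e is a submodule on which e
    is the identity. *)
Lemma irr_central_idempotent e : in_center e -> e * e = e -> X e = 0 \/ X e =
  1%:M.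
Proof.
have [_ _ mulX] := reprX => ze ee.
have [->|Xe0] := eqVneq (X e) 0; [by left | right].
have onto : forall y : 'cV_n, exists v : 'cV_n, X e *m v = y.
  by apply: irr_invariant_onto => // b; exists (X b); rewrite -!mulX ze.
apply: cvmx_ext => y; have [v <-] := onto y.
by rewrite mul1mx mulmxA -mulX ee.
Qed.

End Irreducible.

Lemma repr_iso_sym (K : fieldType) (B : falgType K) n1 (X1 : B -> 'M[K]_n1)
  n2 (X2 : B -> 'M[K]_n2) : repr_iso X1 X2 -> repr_iso X2 X1.
Proof.
move=> [P [Q [PQ QP inter]]]; exists Q, P; split=> // b.
by rewrite -[X2 b]mul1mx -QP -[Q *m P *m _]mulmxA -inter -!mulmxA PQ mulmx1.
Qed.

Lemma repr_iso_trans (K : fieldType) (B : falgType K) n1 (X1 : B -> 'M[K]_n1)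
  n2 (X2 : B -> 'M[K]_n2) n3 (X3 : B -> 'M[K]_n3) :
  repr_iso X1 X2 -> repr_iso X2 X3 -> repr_iso X1 X3.
Proof.
move=> [P [Q [PQ QP i12]]] [P' [Q' [PQ' QP' i23]]].
exists (P *m P'), (Q' *m Q); split=> [||b].
- by rewrite mulmxA -[_ *m P' *m _]mulmxA PQ' mulmx1.
- by rewrite mulmxA -[_ *m Q *m _]mulmxA QP mulmx1.
by rewrite mulmxA i12 -mulmxA i23 mulmxA.
Qed.

Lemma repr_iso_conj (K : fieldType) (B : falgType K) n1 (X1 : B -> 'M[K]_n1)
  n2 (X2 : B -> 'M[K]_n2) : repr_iso X1 X2 ->
  exists P Q, [/\ P *m Q = 1%:M, Q *m P = 1%:M & forall b, X1 b =
    P *m X2 b *m Q].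
Proof.
move=> [P [Q [PQ QP inter]]]; exists P, Q; split=> // b.
by rewrite -inter -mulmxA PQ mulmx1.
Qed.

Lemma repr_iso_dim (K : fieldType) (B : falgType K) n1 (X1 : B -> 'M[K]_n1)
  n2 (X2 : B -> 'M[K]_n2) : repr_iso X1 X2 -> n1 = n2.
Proof.
by move=> [P [Q [PQ QP _]]]; apply/eqP;
  rewrite eqn_leq (mulmx1_min PQ) (mulmx1_min QP).
Qed.

Lemma commute_all_scalar (K : fieldType) n (A : 'M[K]_n) :
  (forall M, A *m M = M *m A) -> exists c, A = c%:M.
Proof.
case: n A => [|n] A cA; first by exists 0; apply/matrixP => -[].
exists (A 0 0); apply/matrixP => i j.
have /matrixP/(_ i 0) := cA (delta_mx j 0).
rewrite -(mul_delta_mx (0 : 'I_1)) mulmxA -colE -!mulmxA -rowE !mxE !big_ord1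
  !mxE.
by rewrite !eqxx /= mulr1 andbT => ->; case: (i == j); rewrite ?mul1r ?mul0r.
Qed.

Section CentralCharacter.

Variables (K : fieldType) (B : falgType K) (n : nat) (X : B -> 'M[K]_n).
Hypothesis n_gt0 : (0 < n)%N.

Lemma scalar_mx_injective : injective (fun c : K => c%:M : 'M_n).
Proof.
by move=> c c' /matrixP/(_ (Ordinal n_gt0) (Ordinal n_gt0)); rewrite !mxE eqxx.
Qed.

Lemma central_charE z c : X z = c%:M -> central_char X z = c.
Proof.
move=> Xz; apply: scalar_mx_injective; rewrite -Xz; apply/esym.
exact: (@classical_sets.xgetPex _ 0 (fun c : K => X z = c%:M)
  (ex_intro _ c Xz)).
Qed.

Lemma central_char1 z : central_char X z = 1 -> X z = 1%:M.
Proof.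
have [[c Xz]|noc] := pselect (exists c, X z = c%:M).
  by rewrite (central_charE Xz) => c1; rewrite Xz c1.
rewrite /central_char classical_sets.xgetPN => [/eqP|c Xz]; last by apply: noc;
  exists c.
by rewrite eq_sym oner_eq0.
Qed.

End CentralCharacter.

Section SplitSemisimple.

Variables (K : fieldType) (B : falgType K).
Variables (J : finType) (d : J -> nat) (rho : forall j, B -> 'M[K]_(d j)).
Hypothesis rhoP : forall j, is_repr (rho j) /\ (0 < d j)%N.
Hypothesis rho_bij :
  forall M : forall j, 'M[K]_(d j), exists! b, forall j, rho j b = M j.

Let lin_rho j : linear (rho j). Proof. by have [[]] := rhoP j. Qed.
Let mul_rho j x y : rho j (x * y) = rho j x *m rho j y.
Proof. by have [[]] := rhoP j. Qed.
Let rho1 j : rho j 1 = 1%:M. Proof. by have [[]] := rhoP j. Qed.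

Lemma split_inj b b' : (forall j, rho j b = rho j b') -> b = b'.
Proof.
move=> eqb; have [c [_ uc]] := rho_bij (fun j => rho j b').
by rewrite -(uc _ eqb) (uc b').
Qed.

(** The element that acts as M on the module of rho j and as 0 on the others.
    The conforming cast identifies the two index types once i and j are known
    to be equal. *)
Definition split_elt j (M : 'M[K]_(d j)) : B :=
  the_elt 0 (fun b => forall i, rho i b = if i == j then conform_mx 0 M else 0).

Lemma split_eltE j (M : 'M[K]_(d j)) i :
  rho i (split_elt M) = if i == j then conform_mx 0 M else 0.
Proof.
move: i; apply: (@classical_sets.xgetPex _ _
  (fun b => forall i, rho i b = if i == j then conform_mx 0 M else 0)).
by have [b [Hb _]] := rho_bij (fun i => if i == j then conform_mx 0 M else 0);
  exists b.
Qed.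

Lemma split_elt_same j (M : 'M[K]_(d j)) : rho j (split_elt M) = M.
Proof. by rewrite split_eltE eqxx conform_mx_id. Qed.

Lemma split_elt_other j (M : 'M[K]_(d j)) i : i != j -> rho i (split_elt M) = 0.
Proof. by rewrite split_eltE => /negPf ->. Qed.

Lemma split_mull b j (M : 'M[K]_(d j)) :
  b * split_elt M = split_elt (rho j b *m M).
Proof.
apply: split_inj => i; rewrite mul_rho.
have [->|ij] := eqVneq i j; first by rewrite !split_elt_same.
by rewrite !split_elt_other // mulmx0.
Qed.

Lemma split_mulr b j (M : 'M[K]_(d j)) :
  split_elt M * b = split_elt (M *m rho j b).
Proof.
apply: split_inj => i; rewrite mul_rho.
have [->|ij] := eqVneq i j; first by rewrite !split_elt_same.
by rewrite !split_elt_other // mul0mx.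
Qed.

Lemma split_linear j : linear (@split_elt j).
Proof.
move=> k M M'; apply: split_inj => i; rewrite lin_rho.
have [->|ij] := eqVneq i j; first by rewrite !split_elt_same.
by rewrite !split_elt_other // scaler0 add0r.
Qed.

Definition block j : B := split_elt (1%:M : 'M_(d j)).

Lemma block_central j : in_center (block j).
Proof. by move=> b; rewrite split_mull split_mulr mul1mx mulmx1. Qed.

Lemma block_idem j : block j * block j = block j.
Proof. by rewrite split_mull split_elt_same mul1mx. Qed.

Lemma block_sum : \sum_j block j = 1.
Proof.
apply: split_inj => i; rewrite (lin_sum (lin_rho i)) (bigD1 i) //= big1 ?addr0.
  by rewrite split_elt_same rho1.
by move=> j ji; rewrite split_elt_other // eq_sym.
Qed.

(** A central idempotent below the block acts on the module of rho j by a
    scalar, which is 0 or 1, and on the other modules by 0. *)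
Lemma block_primitive j : central_primitive_idempotent (block j).
Proof.
split=> [||f [zf ff] ef]; first by split;
  [apply: block_central | apply: block_idem].
  apply/eqP => /(congr1 (rho j)); rewrite split_elt_same (lin0 (lin_rho j)).
  move/matrixP => /(_ (Ordinal (rhoP j).2) (Ordinal (rhoP j).2)).
  by rewrite !mxE eqxx => /eqP; rewrite oner_eq0.
have fj i : i != j -> rho i f = 0.
  by move=> ij; rewrite -ef mul_rho split_elt_other ?mul0mx.
have [c Ec] : exists c, rho j f = c%:M.
  apply: commute_all_scalar => M.
  by rewrite -{1 2}[M]split_elt_same -!mul_rho zf.
have /eqP : c * c = c.
  apply: (scalar_mx_injective (rhoP j).2); rewrite /= scalar_mxM -Ec.
  by rewrite -mul_rho ff.
rewrite -subr_eq0 -{3}[c]mulr1 -mulrBr mulf_eq0 subr_eq0 => /orP[] /eqP c01.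
  left; apply: split_inj => i; rewrite (lin0 (lin_rho i)).
  by have [->|/fj//] := eqVneq i j; rewrite Ec c01 raddf0.
right; apply: split_inj => i.
have [->|ij] := eqVneq i j; first by rewrite Ec c01 split_elt_same.
by rewrite fj // split_elt_other.
Qed.

Lemma rho_block i j : rho i (block j) = (i == j)%:R%:M.
Proof.
have [->|ij] := eqVneq i j; first by rewrite split_elt_same.
by rewrite split_elt_other // raddf0.
Qed.

Section IrreducibleModule.

Variables (n : nat) (X : B -> 'M[K]_n).
Hypothesis irrX : irreducible_repr X.

Let lin_X : linear X. Proof. by have [[]] := irrX. Qed.
Let mul_X x y : X (x * y) = X x *m X y. Proof. by have [[]] := irrX. Qed.
Let X1 : X 1 = 1%:M. Proof. by have [[]] := irrX. Qed.

(** The blocks sum to 1 and each acts on X as 0 or 1. *)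
Lemma irr_block : exists j, X (block j) = 1%:M.
Proof.
have [j Xj] : exists j, X (block j) <> 0.
  apply/existsNP => X0; have := X1.
  rewrite -block_sum (lin_sum lin_X) big1 => [/matrixP|//].
  have [_ n_gt0 _] := irrX.
  move/(_ (Ordinal n_gt0) (Ordinal n_gt0)); rewrite !mxE eqxx => /eqP.
  by rewrite eq_sym oner_eq0.
exists j; have [|//] := irr_central_idempotent irrX (@block_central j)
  (block_idem j).
by move/Xj.
Qed.

(** Choose w nonzero and fixed by the matrix unit (o, o). Then the images of w
    under the matrix units (k, o) span a nonzero submodule, so they span X,
    and they are independent; B permutes them as it does the columns of rho j.
    *)
Lemma irr_iso_block j : X (block j) = 1%:M -> repr_iso X (rho j).
Proof.
have [_ n_gt0 _] := irrX => Xj1.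
have d_gt0 := (rhoP j).2.
pose o := Ordinal d_gt0.
pose E k l : B := split_elt (delta_mx k l : 'M_(d j)).
have EE k l p q : E k l * E p q = (l == p)%:R *: E k q.
  rewrite /E split_mull split_elt_same mul_delta_mx_cond.
  by rewrite -scaler_nat (linZ (@split_linear j)).
have [k Xk] : exists k, X (E k k) <> 0.
  apply/existsNP => X0; move: Xj1.
  have -> : block j = \sum_k E k k.
    rewrite /block -(lin_sum (@split_linear j)); congr split_elt.
    rewrite [LHS]matrix_sum_delta; apply: eq_bigr => k _.
    rewrite (bigD1 k) //= big1 ?addr0 ?mxE ?eqxx ?scale1r // => l /negPf lk.
    by rewrite mxE eq_sym lk scale0r.
  rewrite (lin_sum lin_X) big1 => [/matrixP|//].
  move/(_ (Ordinal n_gt0) (Ordinal n_gt0)); rewrite !mxE eqxx => /eqP.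
  by rewrite eq_sym oner_eq0.
have [v Ev] : exists v : 'cV_n, X (E o k) *m v <> 0.
  apply/existsNP => X0; apply: Xk.
  have -> : E k k = E k o * E o k by rewrite EE eqxx scale1r.
  by apply: cvmx_ext => x; rewrite mul_X -mulmxA X0 mulmx0 mul0mx.
pose w := X (E o k) *m v.
have Eow : X (E o o) *m w = w by rewrite mulmxA -mul_X EE eqxx scale1r.
pose P : 'M_(n, d j) := \matrix_(r, l) (X (E l o) *m w) r 0.
have PE y : P *m y = X (split_elt (y *m delta_mx 0 o)) *m w.
  have -> : y *m delta_mx 0 o = \sum_l y l 0 *: delta_mx l o :> 'M_(d j).
    rewrite {1}[y]matrix_sum_delta mulmx_suml; apply: eq_bigr => l _.
    by rewrite big_ord1 -scalemxAl mul_delta_mx.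
  rewrite (lin_sum (@split_linear j)) (lin_sum lin_X) mulmx_suml.
  apply/colP => r; rewrite mxE summxE; apply: eq_bigr => l _.
  by rewrite (linZ (@split_linear j)) (linZ lin_X) -scalemxAl [RHS]mxE mulrC
    mxE.
have interP b : X b *m P = P *m rho j b.
  apply: cvmx_ext => y; rewrite -!mulmxA !PE mulmxA -mul_X split_mull.
  by rewrite mulmxA.
have freeP : row_free P.
  apply: row_free_onto; apply: (irr_invariant_onto irrX) => [b|].
    by exists (rho j b).
  apply/eqP => P0; case: Ev; rewrite -/w -Eow.
  have := PE (delta_mx o 0); rewrite P0 mul0mx mul_delta_mx => ->.
  by [].
have fullP : row_full P.
  apply: row_full_of_inj => y Py0; apply/colP => l; rewrite mxE.
  have : X (E o l) *m (P *m y) = 0 by rewrite Py0 mulmx0.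
  rewrite PE mulmxA -mul_X split_mull split_elt_same mulmxA.
  have -> : delta_mx o l *m y *m delta_mx 0 o = y l 0 *: delta_mx o o.
    have -> : delta_mx o l *m y = y l 0 *: delta_mx o 0.
      rewrite -(mul_delta_mx (0 : 'I_1)) -mulmxA -rowE [row l y]mx11_scalar.
      by rewrite mul_mx_scalar mxE.
    by rewrite -scalemxAl mul_delta_mx.
  rewrite (linZ (@split_linear j)) (linZ lin_X) -scalemxAl Eow => /eqP.
  by rewrite scaler_eq0 => /orP[/eqP//|/eqP w0]; case: Ev.
exists P, (pinvmx P); split=> //; [exact: mulmxVp | exact: mulVpmx].
Qed.

End IrreducibleModule.

End SplitSemisimple.

Section BlockIdempotent.

Variables (K : fieldType) (B : falgType K).
Hypothesis splitB : split_semisimple B.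
Variables (n : nat) (X : B -> 'M[K]_n).
Hypothesis irrX : irreducible_repr X.

Lemma irr_onto M : exists b, X b = M.
Proof.
have [J [d [rho [rhoP rho_bij]]]] := splitB.
have [j /(irr_iso_block rhoP rho_bij irrX) iso] := irr_block rhoP rho_bij irrX.
have [P [Q [PQ _ EX]]] := repr_iso_conj iso.
exists (split_elt rho (Q *m M *m P)).
by rewrite EX split_elt_same // !mulmxA PQ mul1mx -mulmxA PQ mulmx1.
Qed.

(** The block of the matrix factor through which X acts has the property that
    defines the block idempotent; any other choice f agrees with it because
    the product of the two acts as 1 on X, so is nonzero, and both are
    primitive. *)
Lemma block_idempotent_spec (e := block_idempotent X) :
  [/\ central_primitive_idempotent e, X e = 1%:M,
      forall x, x * e = x -> X x = 0 -> x = 0 &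
      forall m (Y : B -> 'M[K]_m), irreducible_repr Y ->
        Y e = 0 \/ Y e = 1%:M /\ repr_iso Y X].
Proof.
have [J [d [rho [rhoP rho_bij]]]] := splitB.
have [j Xj] := irr_block rhoP rho_bij irrX.
have isoX := irr_iso_block rhoP rho_bij irrX Xj.
have [[lin_X X1 mul_X] n_gt0 _] := irrX.
have prim_j := block_primitive rhoP rho_bij j.
have [prim_e chi_e] : central_primitive_idempotent e /\ central_char X e = 1.
  apply: (@classical_sets.xgetPex _ 0 (fun e : B =>
    central_primitive_idempotent e /\ central_char X e = 1)).
  by exists (block rho j); split; [| rewrite (central_charE n_gt0 Xj)].
have Xe := central_char1 n_gt0 chi_e.
have {prim_e chi_e} -> : e = block rho j.
  have [[ze ee] e0 e_min] := prim_e; have [[zj jj] j0 j_min] := prim_j.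
  pose f := e * block rho j.
  have cf : central_idempotent f.
    split; first by move=> b; rewrite /f -mulrA zj mulrA ze mulrA.
    by rewrite /f -mulrA (mulrA _ e) zj -mulrA jj mulrA ee.
  have f0 : f <> 0.
    move=> f0; have := mul_X e (block rho j).
    rewrite -/f f0 (lin0 lin_X) Xe Xj mulmx1 => /matrixP.
    move/(_ (Ordinal n_gt0) (Ordinal n_gt0)); rewrite !mxE eqxx => /eqP.
    by rewrite eq_sym oner_eq0.
  have fe : f = e by have [] := e_min f cf; rewrite // /f mulrA ee.
  have fj : f = block rho j by have [] := j_min f cf;
    rewrite // /f mulrA zj -mulrA jj.
  by rewrite -fe.
split=> // [x xe Xx|m Y irrY].
  apply: (split_inj rho_bij) => i; have [[lin_r _ mul_r] _] := rhoP i.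
  rewrite (lin0 lin_r) -xe mul_r rho_block //.
  have [->|_] := eqVneq i j; last by rewrite raddf0 mulmx0.
  have [P [Q [_ _ Erho]]] := repr_iso_conj (repr_iso_sym isoX).
  by rewrite Erho Xx mulmx0 !mul0mx.
have [|Y1] := irr_central_idempotent irrY (block_central rhoP rho_bij j)
  (block_idem rhoP rho_bij j); first by left.
right; split=> //.
exact: repr_iso_trans (irr_iso_block rhoP rho_bij irrY Y1) (repr_iso_sym isoX).
Qed.

Lemma mxrank_conj m p (M : 'M[K]_m) (M' : 'M[K]_p) (P : 'M_(m, p))
  (Q : 'M_(p, m)) :
  Q *m P = 1%:M -> M = P *m M' *m Q -> \rank M = \rank M'.
Proof.
move=> QP EM; apply/eqP; rewrite eqn_leq; apply/andP; split.
  by rewrite EM (leq_trans (mxrankM_maxl _ _)) ?mxrankM_maxr.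
have -> : M' = Q *m M *m P by rewrite EM !mulmxA QP mul1mx -mulmxA QP mulmx1.
by rewrite (leq_trans (mxrankM_maxl _ _)) ?mxrankM_maxr.
Qed.

(** On a semisimple module, the block idempotent of X projects onto the sum of
    the simple summands isomorphic to X. *)
Lemma multiplicity_rank N (rho : B -> 'M[K]_N) (J : finType) (d : J -> nat)
    (tau : forall j, B -> 'M[K]_(d j)) :
  (forall j, irreducible_repr (tau j)) -> repr_iso rho (dsum_repr tau) ->
  \rank (rho (block_idempotent X)) =
    (#|[pred j | `[< repr_iso (tau j) X >] ]| * n)%N.
Proof.
move=> irr_tau /repr_iso_conj[P [Q [PQ QP E]]].
have [_ Xe _ splitY] := block_idempotent_spec.
rewrite (mxrank_conj QP (E _)) /dsum_repr rank_mxdiag.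
rewrite -(big_enum_val (fun j => \rank (tau j (block_idempotent X)))) /=.
rewrite -sum_nat_const [RHS]big_mkcond; apply: eq_bigr => j _.
rewrite inE; case: asboolP => [isoX|niso].
  have [P' [Q' [PQ' _ ->]]] := repr_iso_conj isoX.
  by rewrite Xe mulmx1 PQ' mxrank1 (repr_iso_dim isoX).
by have [->|[]//] := splitY _ _ (irr_tau j); rewrite mxrank0.
Qed.

End BlockIdempotent.

(** * Matrix units of a split semisimple group algebra *)

Section GroupAlgebra.

Variables (K : fieldType) (gT : finGroupType) (S : {group gT}).
Hypothesis splitKS : group_split_semisimple K S.

(** An invariant complement of the line spanned by N, the sum of the elements
    of S, contains every g - 1. If the order of S were 0 in K, then N would be
    the sum of these g - 1, so would lie in its own complement. *)
Lemma card_group_neq0 : #|S|%:R != 0 :> K.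
Proof.
have [[red _]] := splitKS; apply/eqP => S0.
pose r := regular_repr K S.
pose E g : 'rV[K]_#|S| := delta_mx 0 (gring_index S g).
have Er g h : g \in S -> h \in S -> E g *m r h = E (g * h)%g.
  by move=> Sg Sh; rewrite /E -rowE rowK gring_indexK.
pose N := \sum_(g in S) E g.
have Nr h : h \in S -> N *m r h = N.
  move=> Sh; rewrite mulmx_suml [RHS](reindex_inj (mulIg h)) /=.
  apply: eq_big => [g|g Sg]; last by rewrite Er.
  by rewrite groupMr.
have modN : mxmodule r <<N>>%MS.
  by apply/mxmoduleP => h Sh; rewrite (eqmxMr _ (genmxE N)) Nr // genmxE.
have [W modW sumW dxW] := red _ modN (submx1 _).
have /sub_addsmxP[[u w] /= E1] : (E 1%g <= <<N>> + W)%MS by rewrite sumW submx1.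
have WE g : g \in S -> (E g - E 1%g <= W)%MS.
  move=> Sg; rewrite -[g in E g]mul1g -Er // E1 mulmxDl.
  have -> : u *m <<N>>%MS *m r g = u *m <<N>>%MS.
    have /submxP[d ->] : (u *m <<N>> <= N)%MS.
      by rewrite (submx_trans (submxMl _ _)) ?genmxE.
    by rewrite -mulmxA Nr.
  rewrite opprD addrACA subrr add0r addmx_sub ?eqmx_opp ?submxMl //.
  by rewrite -mulmxA (submx_trans (submxMl _ _)) ?(mxmoduleP modW).
have WN : (N <= W)%MS.
  have -> : N = \sum_(g in S) (E g - E 1%g).
    by rewrite sumrB sumr_const -scaler_nat S0 scale0r subr0.
  exact: summx_sub.
have N0 : N = 0.
  apply/eqP; rewrite -submx0 -(mxdirect_addsP dxW) sub_capmx genmxE submx_refl.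
  exact: WN.
have /rowP/(_ (gring_index S 1%g)) := N0.
rewrite summxE (bigD1 1%g) //= big1 => [|g /andP[Sg g1]].
  by rewrite !mxE !eqxx addr0 => /eqP; rewrite oner_eq0.
rewrite mxE eqxx /=; case: eqP => // /(congr1 enum_val).
by rewrite !gring_indexK // => /eqP; rewrite eq_sym (negPf g1).
Qed.

Variable irrS : irrType K S.

Lemma pchar_group : ([pchar K]^'.-group S)%g.
Proof.
apply/pgroupP => p p_pr pS; rewrite inE /=; apply/negP => charp.
have := card_group_neq0; have /dvdnP[q ->] := pS.
by rewrite natrM (pcharf0 charp) mulr0 eqxx.
Qed.

Lemma sum_degree_sq : (\sum_(xi : irrS) irr_degree xi ^ 2 = #|S|)%N.
Proof.
by have [_ sp] := splitKS; apply: (sum_irr_degree_pchar irrS pchar_group sp).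
Qed.

Lemma irr_abs (xi : irrS) : mx_absolutely_irreducible (irr_repr xi).
Proof. by have [_ sp] := splitKS; apply: sp; apply: socle_irr. Qed.

(** Schur's lemma: a nonzero intertwiner has zero kernel and full image. *)
Lemma intertwiner_eq0 (xi zeta : irrS)
  (F : 'M[K]_(irr_degree zeta, irr_degree xi)) :
    xi != zeta ->
    (forall g, g \in S -> irr_repr zeta g *m F = F *m irr_repr xi g) ->
  F = 0.
Proof.
move=> ne_xi FE; apply: contraNeq ne_xi => F0; apply/eqP.
have [_ irrz] := (mx_irrP _).1 (socle_irr zeta).
have [_ irrx] := (mx_irrP _).1 (socle_irr xi).
have fF : row_free F.
  rewrite -kermx_eq0; apply: contraNT F0 => kF.
  have modk : mxmodule (irr_repr zeta) (kermx F).
    apply/mxmoduleP => g Sg; apply/sub_kermxP.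
    by rewrite -mulmxA FE // mulmxA mulmx_ker mul0mx.
  have /row_fullP[L Lk] := irrz _ modk kF.
  by rewrite -[F]mul1mx -Lk -mulmxA mulmx_ker mulmx0.
have uF : row_full F.
  rewrite /row_full -(mxrank_gen F); apply: irrx;
    last by rewrite -mxrank_eq0 genmxE mxrank_eq0.
  by apply/mxmoduleP => g Sg; rewrite (eqmxMr _ (genmxE F)) genmxE -FE //
    submxMl.
rewrite -(irr_reprK_pchar pchar_group xi) -(irr_reprK_pchar pchar_group zeta).
apply/esym/(irr_comp_rsim_pchar _ pchar_group).
exists F => //; first by rewrite -(eqP fF) (eqP uF).
Qed.

(** The sum over S that turns any matrix into an intertwiner. *)
Definition averaged p q (rp : mx_representation K S p)
  (rq : mx_representation K S q)
    (M : 'M[K]_(p, q)) : 'M[K]_(p, q) :=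
  \sum_(g in S) rp g *m M *m rq g^-1%g.

Lemma averaged_comm p q (rp : mx_representation K S p)
  (rq : mx_representation K S q) M g :
  g \in S -> rp g *m averaged rp rq M = averaged rp rq M *m rq g.
Proof.
move=> Sg; rewrite mulmx_sumr mulmx_suml [RHS](reindex_inj (mulgI g)) /=.
apply: eq_big => [h|h Sh]; first by rewrite groupMl.
rewrite invMg !repr_mxM ?groupV ?groupM // -!mulmxA.
by rewrite -(@repr_mxM _ _ _ _ _ g^-1%g) ?groupV // mulVg repr_mx1 mulmx1.
Qed.

Lemma averaged_trace p (rp : mx_representation K S p) M :
  \tr (averaged rp rp M) = #|S|%:R * \tr M.
Proof.
rewrite raddf_sum /= mulr_natl -sumr_const; apply: eq_bigr => g Sg.
by rewrite mxtrace_mulC mulmxA -repr_mxM ?groupV // mulVg repr_mx1 mul1mx.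
Qed.

Lemma averaged_delta p q (rp : mx_representation K S p)
  (rq : mx_representation K S q) i j r k :
  averaged rp rq (delta_mx i j) r k = \sum_(g in S) rq g^-1%g j k * rp g r i.
Proof.
rewrite summxE; apply: eq_bigr => g Sg; rewrite mulrC.
rewrite -(mul_delta_mx (0 : 'I_1)) !mulmxA -colE -mulmxA -rowE !mxE big_ord1.
by rewrite !mxE.
Qed.

Lemma averaged_scalar (xi : irrS) M :
  exists2 s, averaged (irr_repr xi) (irr_repr xi) M = s%:M &
    #|S|%:R * \tr M = s * (irr_degree xi)%:R.
Proof.
have /is_scalar_mxP[s Es] :
    is_scalar_mx (averaged (irr_repr xi) (irr_repr xi) M).
  apply: (mx_abs_irr_cent_scalar (irr_abs xi)).
  by apply/centgmxP => g Sg; rewrite averaged_comm.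
by exists s; rewrite // -(averaged_trace (irr_repr xi)) Es mxtrace_scalar
  mulr_natr.
Qed.

Lemma trace_delta p (i j : 'I_p) : \tr (delta_mx i j) = (i == j)%:R :> K.
Proof.
rewrite /mxtrace (bigD1 i) //= big1 => [|k /negPf ki]; rewrite mxE.
  by rewrite eqxx addr0.
by rewrite ki.
Qed.

(** The trace of the averaged matrix unit is the order of S, and it is also a
    multiple of the degree. *)
Lemma irr_degree_neq0 (xi : irrS) : (irr_degree xi)%:R != 0 :> K.
Proof.
pose o := Ordinal (irr_degree_gt0 xi).
have [s _ /eqP] := averaged_scalar (delta_mx o o : 'M[K]_(irr_degree xi)).
rewrite trace_delta eqxx; apply: contraTneq => ->.
by rewrite mulr0 mulr1 card_group_neq0.
Qed.

(** Coefficients of an element of the group algebra of S that acts on the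
    module of xi as the matrix unit (k, l), and as 0 on the other simple
    modules. That they do so is Schur's orthogonality relation. *)
Definition unit_coef (xi : irrS) (k l : 'I_(irr_degree xi)) (g : gT) : K :=
  (irr_degree xi)%:R / #|S|%:R * irr_repr xi g^-1%g l k.

Lemma unit_coef_same xi k l :
  \sum_(g in S) @unit_coef xi k l g *: irr_repr xi g = delta_mx k l.
Proof.
apply/matrixP => r p; rewrite summxE.
under eq_bigr => g _ do rewrite mxE -mulrA.
rewrite -mulr_sumr -averaged_delta.
have [s -> Es] := averaged_scalar (delta_mx p l : 'M[K]_(irr_degree xi)).
have nz := irr_degree_neq0 xi.
have {Es} -> : s = #|S|%:R / (irr_degree xi)%:R * (p == l)%:R.
  by rewrite -trace_delta mulrAC Es mulfK.
rewrite !mxE eq_sym [l == p]eq_sym -mulrnAr mulrA mulf_div [X in X / _]mulrC.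
by rewrite divff ?mulf_neq0 ?card_group_neq0 // mul1r; case: (r == k);
  case: (p == l).
Qed.

Lemma unit_coef_other xi zeta k l : xi != zeta ->
  \sum_(g in S) @unit_coef xi k l g *: irr_repr zeta g = 0.
Proof.
move=> ne_xi; apply/matrixP => r p; rewrite summxE.
under eq_bigr => g _ do rewrite mxE -mulrA.
rewrite -mulr_sumr -averaged_delta [averaged _ _ _](intertwiner_eq0 ne_xi) ?mxE
  ?mulr0 // => g.
exact: averaged_comm.
Qed.

Lemma unit_coef1 xi k : @unit_coef xi k k 1%g = (irr_degree xi)%:R / #|S|%:R.
Proof. by rewrite /unit_coef invg1 repr_mx1 mxE eqxx mulr1. Qed.

End GroupAlgebra.

(** * Algebras graded by a group, with a unit in each degree *)

Section Aspace.

Variables (K : fieldType) (B : falgType K) (C : {aspace B}).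
Hypothesis C1 : 1 \in C.

Lemma vsproj_mul x y :
  x \in C -> y \in C -> vsproj C (x * y) = vsproj C x * vsproj C y.
Proof. by move=> Cx Cy; apply: val_inj; rewrite /= !vsprojK ?memvM. Qed.

Lemma vsproj_one : vsproj C 1 = 1.
Proof.
by apply: val_inj; rewrite /= vsprojK //; apply/esym/eqP; rewrite (algid_eq1 C).
Qed.

End Aspace.

Section GradedAlgebra.

Variables (K : fieldType) (B : falgType K) (gT : finGroupType).
Variables (Bg : gT -> {vspace B}) (q : gT -> 'End(B)) (a : gT -> B).

(** A crossed product of its component of degree 1 by the group, written with
    the projections q g onto the components. *)
Record graded_by_units : Prop := GradedByUnits {
  gr_mem : forall g x, q g x \in Bg g;
  gr_sum : forall x, x = \sum_g q g x;
  gr_homog : forall g h x, x \in Bg h -> q g x = if g == h then x else 0;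
  gr_mul : forall g h x y, x \in Bg g -> y \in Bg h -> x * y \in Bg (g * h)%g;
  gr_unit_mem : forall g, a g \in Bg g;
  gr_unit : forall g, a g \is a GRing.unit;
  gr_unit1 : a 1%g = 1
}.

Hypothesis gr : graded_by_units.

Lemma gr_one : 1 \in Bg 1%g.
Proof. by rewrite -(gr_unit1 gr) (gr_unit_mem gr). Qed.

Lemma gr_mull g h x y : y \in Bg h -> q g (y * x) = y * q (h^-1 * g)%g x.
Proof.
move=> By; rewrite {1}(gr_sum gr x) mulr_sumr linear_sum
  (bigD1 (h^-1 * g)%g) //=.
rewrite (gr_homog gr g (gr_mul gr By (gr_mem gr _ _))) mulKVg eqxx.
rewrite big1 ?addr0 // => k kg;
  rewrite (gr_homog gr g (gr_mul gr By (gr_mem gr _ _))).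
by case: eqP => // E; case/eqP: kg; rewrite E mulKg.
Qed.

Lemma gr_mulr g h x y : y \in Bg h -> q g (x * y) = q (g * h^-1)%g x * y.
Proof.
move=> By; rewrite {1}(gr_sum gr x) mulr_suml linear_sum
  (bigD1 (g * h^-1)%g) //=.
rewrite (gr_homog gr g (gr_mul gr (gr_mem gr _ _) By)) mulgKV eqxx.
rewrite big1 ?addr0 // => k kg;
  rewrite (gr_homog gr g (gr_mul gr (gr_mem gr _ _) By)).
by case: eqP => // E; case/eqP: kg; rewrite E mulgK.
Qed.

(** The component of degree g^-1 of the inverse is already a right inverse of
    a g, because 1 is homogeneous of degree 1. *)
Lemma gr_invr_mem g : (a g)^-1 \in Bg g^-1%g.
Proof.
have ag := gr_unit gr g.
suff -> : (a g)^-1 = q g^-1%g (a g)^-1 by apply: (gr_mem gr).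
have := gr_mull 1%g (a g)^-1 (gr_unit_mem gr g).
rewrite mulg1 divrr // (gr_homog gr _ gr_one) eqxx => E.
by apply: (mulrI ag); rewrite divrr.
Qed.

Lemma gr_memP g x : x \in Bg g -> exists2 c, c \in Bg 1%g & x = a g * c.
Proof.
move=> Bx; exists ((a g)^-1 * x); last by rewrite mulVKr ?(gr_unit gr).
by rewrite -(mulVg g) (gr_mul gr) ?gr_invr_mem.
Qed.

Section Subgroup.

Variables (S : {group gT}) (C : {aspace B}).
Hypothesis memC : forall x, x \in C <-> (forall g, g \notin S -> q g x = 0).

Lemma sub_homog g x : g \in S -> x \in Bg g -> x \in C.
Proof.
move=> Sg Bx; apply/memC => h; rewrite (gr_homog gr h Bx).
by case: eqP => // -> /negP.
Qed.

Lemma sub_one : 1 \in C.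
Proof. exact: sub_homog (group1 S) gr_one. Qed.

Lemma sub_sum_comp x : x \in C -> x = \sum_(g in S) q g x.
Proof.
move=> /memC Cx; rewrite {1}(gr_sum gr x) (bigID [in S]) /= addrC big1
  ?add0r //.
Qed.

(** The left cosets of S index a basis of B as a right C-module. *)
Definition coset_index := {L : {set gT} | L \in lcosets S [set: gT]}.

Definition coset_rep (j : coset_index) : gT := repr (val j).

Lemma left_coset_of_subproof g : (g *: S)%g \in lcosets S [set: gT].
Proof. by apply/lcosetsP; exists g. Qed.

Definition left_coset_of (g : gT) :
  coset_index := Sub (g *: S)%g (left_coset_of_subproof g).

Lemma coset_val j : val j = (coset_rep j *: S)%g.
Proof.
rewrite /coset_rep; case/lcosetsP: (valP j) => x _ /= ->.
by apply/esym/lcoset_eqP/(mem_repr x)/lcoset_refl.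
Qed.

Lemma left_coset_ofE g j : (left_coset_of g == j) =
  ((coset_rep j)^-1 * g \in S)%g.
Proof.
rewrite -val_eqE /= coset_val -mem_lcoset.
by apply/eqP/idP => [<-|/lcoset_eqP//]; apply: lcoset_refl.
Qed.

Lemma left_coset_of_rep j : left_coset_of (coset_rep j) = j.
Proof. by apply/eqP; rewrite left_coset_ofE mulVg. Qed.

Lemma coset_rep1 : coset_rep (left_coset_of 1%g) = 1%g.
Proof. by rewrite /coset_rep /= mul1g repr_group. Qed.

Lemma coset_sum (V : nmodType) (F : gT -> V) :
  \sum_g F g = \sum_(j : coset_index) \sum_(g in S) F (coset_rep j * g)%g.
Proof.
rewrite (partition_big left_coset_of predT) //=; apply: eq_bigr => j _.
rewrite (reindex_inj (mulgI (coset_rep j))) /=; apply: eq_bigl => g.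
by rewrite left_coset_ofE mulKg.
Qed.

Lemma card_coset_index : #|{: coset_index}| = #|[set: gT] : S|%g.
Proof. by rewrite card_sig -card_lcosets; apply: eq_card. Qed.

Definition coset_elt j : B := a (coset_rep j).

(** Moving the part of b of degree in the coset back by the inverse of the
    unit of its representative lands in C. *)
Definition coset_coord j (b : B) : subvs_of C :=
  vsproj C ((coset_elt j)^-1 * \sum_(g in S) q (coset_rep j * g)%g b).

Lemma val_coset_coord j b :
  vsval (coset_coord j b) = (coset_elt j)^-1 * \sum_(g in S) q
    (coset_rep j * g)%g b.
Proof.
apply: vsprojK; rewrite mulr_sumr; apply: memv_suml => g Sg.
apply: (sub_homog Sg); rewrite -[g in Bg g](mulKg (coset_rep j)).
by rewrite (gr_mul gr) ?gr_invr_mem ?(gr_mem gr).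
Qed.

Lemma coset_coord_linear j : linear (coset_coord j).
Proof.
move=> k b c; apply: val_inj; rewrite linearP /= !val_coset_coord.
rewrite scalerAr -mulrDr scaler_sumr -big_split; congr (_ * _).
by apply: eq_bigr => g _; rewrite linearP.
Qed.

(** Right multiplication by C preserves each left coset of degrees. *)
Lemma coset_coord_mul j b (c : subvs_of C) :
  coset_coord j (b * vsval c) = coset_coord j b * c.
Proof.
apply: val_inj; rewrite /= !val_coset_coord -mulrA; congr (_ * _).
rewrite {1}(sub_sum_comp (subvsP c)).
under eq_bigr => g _ do rewrite mulr_sumr linear_sum.
rewrite exchange_big {2}(sub_sum_comp (subvsP c)) mulr_sumr.
apply: eq_bigr => h Sh /=; rewrite mulr_suml
  [RHS](reindex_inj (mulIg h^-1%g)) /=.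
apply: eq_big => [g|g Sg]; first by rewrite groupMr ?groupV.
by rewrite (gr_mulr _ _ (gr_mem gr _ _)) mulgA.
Qed.

Lemma coset_coord_sum b : b = \sum_j coset_elt j * vsval (coset_coord j b).
Proof.
rewrite {1}(gr_sum gr b) coset_sum; apply: eq_bigr => j _.
by rewrite val_coset_coord mulVKr ?(gr_unit gr).
Qed.

Lemma coset_coord_dual i j : coset_coord i (coset_elt j) = (i == j)%:R.
Proof.
apply: val_inj; rewrite /= val_coset_coord.
have -> : \sum_(g in S) q (coset_rep i * g)%g (coset_elt j) =
    if i == j then coset_elt j else 0.
  under eq_bigr => g _ do rewrite (gr_homog gr _ (gr_unit_mem gr _)).
  rewrite -big_mkcondr /=; case: eqVneq => [->|ij].
    rewrite (big_pred1 1%g) // => g /=.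
    rewrite -{2}[coset_rep j]mulg1 (inj_eq (mulgI _)).
    by case: eqP => [->|]; rewrite ?group1 ?andbF.
  rewrite big_pred0 // => g; apply: contra_neqF ij => /andP[Sg /eqP E].
  by apply/esym/eqP; rewrite -(left_coset_of_rep j) -E left_coset_ofE mulKg.
case: eqVneq => [->|_]; last by rewrite mulr0 linear0.
by rewrite mulVr ?(gr_unit gr) //; apply/esym/eqP;
  rewrite (algid_eq1 C) sub_one.
Qed.

End Subgroup.

End GradedAlgebra.

(** * Induction from a graded subalgebra; Schur elements *)

Section InductionFromSubgroup.

Variables (K : fieldType) (B : falgType K) (gT : finGroupType).
Variables (Bg : gT -> {vspace B}) (q : gT -> 'End(B)) (a : gT -> B).
Hypothesis gr : graded_by_units Bg q a.
Variables (S : {group gT}) (C : {aspace B}).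
Hypothesis memC : forall x, x \in C <-> (forall g, g \notin S -> q g x = 0).
Variables (n : nat) (rho : subvs_of C -> 'M[K]_n).
Hypothesis rho_repr : is_repr rho.

Local Notation incl := (vsval : subvs_of C -> B).
Local Notation T := (ind_tens incl rho).
Local Notation cf := (@coset_coord K B gT q a S C).
Local Notation Pi := (ind_proj incl cf rho).
Local Notation V := (ind_repr incl rho).
Local Notation w := (@coset_elt K B gT a S).

Let lin_cf := coset_coord_linear gr memC.
Let cf_mul := coset_coord_mul gr memC.
Let cf_sum := coset_coord_sum gr memC.
Let cf_dual := coset_coord_dual gr memC.

Lemma coset_tens_proj j b : Pi j *m T b = rho (cf j b).
Proof. exact: (ind_proj_tens lin_cf cf_mul). Qed.

Lemma coset_tens_dual i j : Pi i *m T (w j) = (i == j)%:R%:M.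
Proof.
have [lin_rho rho1 _] := rho_repr.
rewrite coset_tens_proj cf_dual.
by case: eqP => _; rewrite ?rho1 ?(lin0 lin_rho) ?raddf0.
Qed.

Lemma coset_tens_sum : \sum_j T (w j) *m Pi j = 1%:M.
Proof. exact: (ind_tens_decomposition lin_cf cf_mul cf_sum). Qed.

Lemma coset_ind_dim : \dim (ind_space incl rho) = (#|[set: gT] : S|%g * n)%N.
Proof.
by rewrite -card_coset_index;
  apply: (dim_ind_space lin_cf cf_mul cf_sum cf_dual).
Qed.

Lemma coset_ind_ext p (M M' : 'M_(p, _)) :
  (forall j, M *m T (w j) = M' *m T (w j)) -> M = M'.
Proof.
move=> eqM; rewrite -[M]mulmx1 -[M']mulmx1 -coset_tens_sum !mulmx_sumr.
by apply: eq_bigr => j _; rewrite !mulmxA eqM.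
Qed.

Lemma coset_ind_repr : is_repr V.
Proof. exact: (ind_repr_is_repr lin_cf cf_mul cf_sum). Qed.

Lemma coset_tens_sub b c : c \in C -> T (b * c) = T b *m rho (vsproj C c).
Proof. by move=> Cc; rewrite -ind_tens_balanced vsprojK. Qed.

End InductionFromSubgroup.

(** Over a field, that a |-> t (a _) is an isomorphism onto the dual is
    equivalent to the existence of dual bases, a form that passes to scalar
    extensions. *)
Definition symmetrizing_over (K : fieldType) (B : falgType K) (t : B -> K) :
  Prop :=
  [/\ linear (t : B -> K^o), forall x y, t (x * y) = t (y * x) &
      exists (I : finType) (b d : I -> B), forall u, u =
        \sum_i t (d i * u) *: b i].

Section SchurElement.

Variables (K : fieldType) (B : falgType K) (t : B -> K).
Hypothesis symt : symmetrizing_over t.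

Lemma form_nondegenerate v : (forall x, t (v * x) = 0) -> v = 0.
Proof.
have [_ tC [I [b [d dual]]]] := symt => v0.
by rewrite [v]dual big1 // => i _; rewrite tC v0 scale0r.
Qed.

Lemma dual_elementP (f : B -> K) : linear (f : B -> K^o) ->
  forall x, t (dual_element t f * x) = f x.
Proof.
have [lin_t tC [I [b [d dual]]]] := symt => lin_f.
apply: (@classical_sets.xgetPex _ 0 (fun v : B => forall x, t (v * x) = f x)).
exists (\sum_i f (b i) *: d i) => x.
rewrite [in RHS](dual x) mulr_suml (lin_sum lin_t) (lin_sum lin_f).
apply: eq_bigr => i _; rewrite -scalerAl (linZ lin_t) (linZ lin_f).
exact: mulrC.
Qed.

Variables (n : nat) (X : B -> 'M[K]_n).
Hypotheses (n_gt0 : (0 < n)%N) (reprX : is_repr X).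
Hypothesis ontoX : forall M, exists b, X b = M.

(** The dual element of a character is central because t is nondegenerate and
    both t and the character are trace functions; it then acts as a scalar
    because X is onto. *)
Lemma schur_elementP (v := dual_element t (repr_char X)) :
  (forall x, t (v * x) = \tr (X x)) /\ X v = (schur_element t X)%:M.
Proof.
have [lin_X _ mul_X] := reprX; have [lin_t tC _] := symt.
have lin_chi : linear (repr_char X : B -> K^o).
  by move=> k x y; rewrite /repr_char lin_X linearP.
have tv := dual_elementP lin_chi; split=> //.
have zv : in_center v.
  move=> x; apply/eqP; rewrite -subr_eq0; apply/eqP/form_nondegenerate => y.
  rewrite mulrBl (linB lin_t) -!mulrA [t (x * _)]tC -!mulrA !tv.
  by rewrite /repr_char !mul_X mxtrace_mulC subrr.
have [c Xv] : exists c, X v = c%:M.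
  apply: commute_all_scalar => M; have [b <-] := ontoX M.
  by rewrite -!mul_X zv.
by rewrite /schur_element -/v (central_charE n_gt0 Xv).
Qed.

End SchurElement.

Section JointlyOnto.

Variables (K : fieldType) (B : falgType K).

Lemma onto_irreducible n (X : B -> 'M[K]_n) :
  is_repr X -> (0 < n)%N -> (forall M, exists b, X b = M) -> irreducible_repr X.
Proof.
move=> reprX n_gt0 ontoX; split=> // W stW.
have [->|W0] := eqVneq W 0%VS; [by left | right].
apply/eqP; rewrite eqEsubv subvf; apply/subvP => y _.
have nz := vpick0 W; have Wv := memv_pick W; set v := vpick W in nz Wv.
have [i vi] : exists i, v i 0 != 0.
  apply/existsP; apply: contraNT W0; rewrite negb_exists => /forallP v0.
  rewrite -nz; apply/eqP/colP => i; rewrite mxE; apply/eqP/negPn/v0.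
have [b Xb] := ontoX ((v i 0)^-1 *: (y *m delta_mx 0 i)).
have <- : X b *m v = y; last exact: stW.
rewrite Xb -scalemxAl -mulmxA -rowE [row i v]mx11_scalar mxE mul_mx_scalar.
by rewrite scalerA mulVf ?scale1r.
Qed.

Variables (I : finType) (N : I -> nat) (V : forall i, B -> 'M[K]_(N i)).
Hypothesis N_gt0 : forall i, (0 < N i)%N.
Hypothesis jointly_onto :
  forall M : forall i, 'M[K]_(N i), exists b, forall i, V i b = M i.

Lemma jointly_onto_at i M : exists b, V i b = M.
Proof.
have [b Vb] := jointly_onto
  (fun j => if j == i then conform_mx (0 : 'M_(N j)) M else 0).
by exists b; rewrite Vb eqxx conform_mx_id.
Qed.

(** A matrix unit of trace 1 on one module can be lifted to an element that
    acts as 0 on the other; this separates the characters in any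
    characteristic. *)
Lemma jointly_onto_char i j : i <> j -> ~ (repr_char (V i) =1 repr_char (V j)).
Proof.
move=> ij eqV; pose o := Ordinal (N_gt0 i).
have [b Vb] := jointly_onto
  (fun k => if k == i then conform_mx (0 : 'M_(N k)) (delta_mx o o : 'M_(N i))
    else 0).
have := eqV b; rewrite /repr_char !Vb eqxx conform_mx_id.
case: eqP => [/esym//|_]; rewrite trace_delta eqxx mxtrace0 => /eqP.
by rewrite oner_eq0.
Qed.

End JointlyOnto.

(** * Clifford theory for a stabilizer *)

Section CliffordCorrespondence.

Variables (K : fieldType) (B : falgType K) (gT : finGroupType).
Variables (Bg : gT -> {vspace B}) (q : gT -> 'End(B)) (a : gT -> B).
Hypothesis gr : graded_by_units Bg q a.

Variable Cb : {aspace B}.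
Hypothesis memCb : forall x, x \in Cb <->
  (forall g, g \notin [1 gT]%G -> q g x = 0).
Hypothesis splitCb : split_semisimple (subvs_of Cb).
Variables (nb : nat) (Xb : subvs_of Cb -> 'M[K]_nb).
Hypothesis irrXb : irreducible_repr Xb.

Variables (S : {group gT}) (CS : {aspace B}).
Hypothesis memCS : forall x, x \in CS <-> (forall g, g \notin S -> q g x = 0).
Hypothesis stabS : forall g, (g \in S) =
  (a g * vsval (block_idempotent Xb) * (a g)^-1 == vsval (block_idempotent Xb)).

Variables (n : nat) (X : subvs_of CS -> 'M[K]_n).
Hypothesis reprX : is_repr X.
Hypothesis extX : repr_iso (fun c : subvs_of Cb => X (vsproj CS (vsval c))) Xb.

Hypothesis splitKS : group_split_semisimple K S.
Variable irrS : irrType K S.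
Variable Y : forall xi : irrS, subvs_of CS -> 'M[K]_(n * irr_degree xi).
Hypothesis YE : forall xi x, Y xi x =
  \sum_(g in S) tprod (X (vsproj CS (q g (vsval x)))) (irr_repr xi g).

(* B, Cb, CS and Y xi stand for KA, KAbar, KA_S and the tensor product of X with
   the module of xi. The function r extends the action on X to all of B, so that
   products of elements of Cb, CS and B need no casts. *)
Let e : B := vsval (block_idempotent Xb).
Let r (b : B) : 'M[K]_n := X (vsproj CS b).

Let lin_r : linear r.
Proof. by have [lin_X _ _] := reprX => k x y; rewrite /r linearP lin_X. Qed.

Let r_mul x y : x \in CS -> y \in CS -> r (x * y) = r x *m r y.
Proof. by have [_ _ mX] := reprX => *; rewrite /r vsproj_mul. Qed.

Let r1 : r 1 = 1%:M.
Proof.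
by have [_ X1 _] := reprX; rewrite /r vsproj_one // (sub_one gr memCS).
Qed.

Lemma mem_bar_homog x : x \in Cb <-> x \in Bg 1%g.
Proof.
split=> [/memCb x1|Bx]; last exact: (sub_homog gr memCb (group1 _) Bx).
suff -> : x = q 1%g x by apply: (gr_mem gr).
rewrite {1}(gr_sum gr x) (bigD1 1%g) //= big1 ?addr0 // => g g1.
by rewrite x1 // inE.
Qed.

Lemma bar_subset x : x \in Cb -> x \in CS.
Proof.
by move/mem_bar_homog => Bx; apply: (sub_homog gr memCS (group1 S) Bx).
Qed.

Let nb_gt0 : (0 < nb)%N. Proof. by have [] := irrXb. Qed.

Let X_conj_Xb : exists P Q, [/\ P *m Q = 1%:M, Q *m P = 1%:M,
  forall c : subvs_of Cb, r (vsval c) = P *m Xb c *m Q &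
  forall c : subvs_of Cb, Xb c = Q *m r (vsval c) *m P].
Proof.
have [P [Q [PQ QP rX]]] := repr_iso_conj extX; exists P, Q; split=> // c.
by rewrite /r rX !mulmxA QP mul1mx -mulmxA QP mulmx1.
Qed.

Lemma bar_onto M : exists u, u \in Cb /\ r u = M.
Proof.
have [P [Q [PQ QP rX XbE]]] := X_conj_Xb.
have [c Xc] := irr_onto splitCb irrXb (Q *m M *m P).
exists (vsval c); split; first exact: subvsP.
by rewrite rX Xc !mulmxA PQ mul1mx -mulmxA PQ mulmx1.
Qed.

Lemma bar_block_mem : e \in Cb. Proof. exact: subvsP. Qed.

Lemma bar_block_idem : e * e = e.
Proof.
have [[[_ ee] _ _] _ _ _] := block_idempotent_spec splitCb irrXb.
by move/(congr1 vsval): ee.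
Qed.

Lemma bar_block_central x : x \in Cb -> e * x = x * e.
Proof.
have [[[ze _] _ _] _ _ _] := block_idempotent_spec splitCb irrXb => Cx.
have := ze (vsproj Cb x); move/(congr1 vsval).
by rewrite /= vsprojK.
Qed.

Lemma bar_block_act : r e = 1%:M.
Proof.
have [P [Q [PQ QP rX XbE]]] := X_conj_Xb.
have [_ Xe _ _] := block_idempotent_spec splitCb irrXb.
by rewrite rX Xe mulmx1.
Qed.

Lemma bar_block_faithful x : x \in Cb -> x * e = x -> r x = 0 -> x = 0.
Proof.
have [P [Q [PQ QP rX XbE]]] := X_conj_Xb.
have [_ _ inj _] := block_idempotent_spec splitCb irrXb => Cx xe rx.
rewrite -(vsprojK Cx) (inj (vsproj Cb x)) ?linear0 //.
  by apply: val_inj; rewrite /= vsprojK.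
by rewrite XbE vsprojK // rx mulmx0 mul0mx.
Qed.

Lemma conj_mem g x : x \in Cb -> a g * x * (a g)^-1 \in Cb.
Proof.
move/mem_bar_homog => Bx; apply/mem_bar_homog;
  rewrite -(mulgV g) -[g in (g * _)%g]mulg1.
by rewrite !(gr_mul gr) ?(gr_unit_mem gr) ?(gr_invr_mem gr).
Qed.

Lemma conjV_mem g x : x \in Cb -> (a g)^-1 * x * a g \in Cb.
Proof.
move/mem_bar_homog => Bx; apply/mem_bar_homog;
  rewrite -(mulVg g) -[in X in (X * _)%g](mulg1 g^-1%g).
by rewrite !(gr_mul gr) ?(gr_unit_mem gr) ?(gr_invr_mem gr).
Qed.

Lemma conj_bar_block_central g x : x \in Cb ->
  (a g * e * (a g)^-1) * x = x * (a g * e * (a g)^-1).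
Proof.
move=> Cx; have ag := gr_unit gr g; have Cy := conjV_mem g Cx.
have -> : x = a g * ((a g)^-1 * x * a g) * (a g)^-1.
  by rewrite !mulrA divrr // mul1r mulrK.
move: (_ * a g) Cy => y Cy.
by rewrite !mulrA !divrK // -![a g * _ * _]mulrA bar_block_central.
Qed.

Lemma conjV_bar_block_central g x : x \in Cb ->
  ((a g)^-1 * e * a g) * x = x * ((a g)^-1 * e * a g).
Proof.
move=> Cx; have ag := gr_unit gr g; have Cy := conj_mem g Cx.
have -> : x = (a g)^-1 * (a g * x * (a g)^-1) * a g.
  by rewrite !mulrA mulVr // mul1r divrK.
move: (_ / a g) Cy => y Cy.
by rewrite !mulrA !mulrK // -![(a g)^-1 * _ * _]mulrA bar_block_central.
Qed.

(** A conjugate of e is a central idempotent, so by primitivity its product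
    with e is 0 or e. In the second case the inverse conjugate of e lies below
    e, hence is e, and g stabilizes e. *)
Lemma bar_block_orthogonal g : g \notin S -> e * a g * e = 0.
Proof.
move=> nSg; have ag := gr_unit gr g.
have [[[_ _] e0 e_min] _ _ _] := block_idempotent_spec splitCb irrXb.
have minB f : f \in Cb -> (forall x, x \in Cb -> f * x = x * f) -> f * f = f ->
    e * f = f -> f = 0 \/ f = e.
  move=> Cf zf ff ef.
  have [||f0|fe] := e_min (vsproj Cb f).
  - split; last by apply: val_inj; rewrite /= vsprojK.
    by move=> b; apply: val_inj; rewrite /= vsprojK // zf ?subvsP.
  - by apply: val_inj; rewrite /= vsprojK.
  - by left; rewrite -(vsprojK Cf) f0 linear0.
  - by right; rewrite -(vsprojK Cf) fe.
pose f := a g * e * (a g)^-1; pose f' := (a g)^-1 * e * a g.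
have Cf : f \in Cb by apply: conj_mem bar_block_mem.
have Cf' : f' \in Cb by apply: conjV_mem bar_block_mem.
have zf x : x \in Cb -> f * x = x * f by apply: conj_bar_block_central.
have ff : f * f = f by rewrite /f !mulrA divrK // -[a g * e * e]mulrA
  bar_block_idem.
have ff' : f' * f' = f'.
  by rewrite /f' !mulrA mulrK // -[(a g)^-1 * e * e]mulrA bar_block_idem.
have [ef0|efe] : e * f = 0 \/ e * f = e.
  apply: minB => [|x Cx||]; first exact: (memvM bar_block_mem Cf).
  - by rewrite -mulrA zf // mulrA bar_block_central // mulrA.
  - by rewrite -mulrA [f * _]mulrA zf ?bar_block_mem // -[e * f * f]mulrA ff
      mulrA bar_block_idem.
  - by rewrite mulrA bar_block_idem.
  by have /(congr1 ( *%R^~ (a g))) := ef0; rewrite /f !mulrA divrK // mul0r.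
have [f0|fe] : f' = 0 \/ f' = e.
- apply: minB => //; first exact: conjV_bar_block_central.
  by rewrite bar_block_central // /f' -[in RHS]efe /f !mulrA divrK.
- case/eqP: e0; apply: val_inj; rewrite linear0 /= -/e.
  have -> : e = a g * f' * (a g)^-1 by rewrite /f' !mulrA divrr // mul1r mulrK.
  by rewrite f0 mulr0 mul0r.
case/negP: nSg; rewrite stabS -/e -{1}fe /f' !mulrA divrr // mul1r mulrK //.
Qed.

(** Outside the stabilizer, homogeneous elements send the block of e into a
    different block. *)
Lemma bar_block_sandwich g y : g \notin S -> y \in Bg g -> e * y * e = 0.
Proof.
move=> nSg /(gr_memP gr)[c /mem_bar_homog Cc ->].
by rewrite -mulrA -mulrA -bar_block_central // !mulrA bar_block_orthogonal
  ?mul0r.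
Qed.

Lemma twist_homog xi g x : g \in S -> x \in Bg g ->
  Y xi (vsproj CS x) = tprod (r x) (irr_repr xi g).
Proof.
move=> Sg Bx; rewrite YE vsprojK ?(sub_homog gr memCS Sg Bx) // (bigD1 g) //=.
rewrite big1 => [|h /andP[Sh /negPf hg]].
  by rewrite addr0 (gr_homog gr g Bx) eqxx.
by rewrite (gr_homog gr h Bx) hg -/(r 0) (lin0 lin_r) -(scale0r (0 : 'M_n))
  tprodZl scale0r.
Qed.

Lemma twist_linear xi : linear (Y xi).
Proof.
have [lin_X _ _] := reprX.
move=> k x y; rewrite !YE scaler_sumr -big_split; apply: eq_bigr => g Sg.
by rewrite !linearP lin_X tprodDl tprodZl.
Qed.

Lemma twist_bar xi x : x \in Cb -> Y xi (vsproj CS x) = tprod (r x) 1%:M.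
Proof.
by move/mem_bar_homog => Bx; rewrite (twist_homog _ (group1 S) Bx) repr_mx1.
Qed.

Lemma twist_is_repr xi : is_repr (Y xi).
Proof.
split; first exact: twist_linear.
  by rewrite -(vsproj_one (sub_one gr memCS)) twist_bar ?(sub_one gr memCb) //
    r1 tprod1.
move=> x y; rewrite -(vsvalK x) -(vsvalK y).
have Cx := subvsP x; have Cy := subvsP y.
rewrite -vsproj_mul // (sub_sum_comp gr memCS Cx) (sub_sum_comp gr memCS Cy).
rewrite mulr_suml !linear_sum !(lin_sum (@twist_linear xi)) mulmx_suml.
apply: eq_bigr => g Sg; rewrite mulr_sumr linear_sum
  (lin_sum (@twist_linear xi)) mulmx_sumr.
apply: eq_bigr => h Sh.
have Bx := gr_mem gr g (vsval x); have By := gr_mem gr h (vsval y).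
rewrite (twist_homog _ Sg Bx) (twist_homog _ Sh By)
  (twist_homog _ (groupM Sg Sh) (gr_mul gr Bx By)).
rewrite repr_mxM // r_mul ?tprodE //.
  exact: (sub_homog gr memCS Sg Bx).
exact: (sub_homog gr memCS Sh By).
Qed.

Lemma tprod0r m (M : 'M[K]_n) : tprod M (0 : 'M[K]_m) = 0.
Proof. by rewrite -(scale0r (0 : 'M_m)) tprodZr scale0r. Qed.

Lemma tprod_sumr m (I : Type) (s : seq I) (P : pred I) (M : 'M[K]_n)
  (F : I -> 'M[K]_m) :
  tprod M (\sum_(i <- s | P i) F i) = \sum_(i <- s | P i) tprod M (F i).
Proof. exact: (big_morph _ (tprodDr M) (tprod0r _ M)). Qed.

(** As KAbar acts on X through all matrices and a g is invertible, some u_g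
    a_g of degree g acts on X as M; combine these with the coefficients k. The
    last clause records the part of degree 1, on which t depends. *)
Lemma lift_tprod (M : 'M[K]_n) (k : gT -> K) : exists u c,
  [/\ u \in Cb, r u = M, c \in CS,
      forall xi, Y xi (vsproj CS c) =
        tprod M (\sum_(g in S) k g *: irr_repr xi g) &
      q 1%g c = k 1%g *: u].
Proof.
have [u Hu] := choice (fun g => bar_onto (M *m r (a g)^-1)).
have Bu g : u g * a g \in Bg g.
  rewrite -[g in Bg g]mul1g (gr_mul gr) ?(gr_unit_mem gr) //.
  by apply/mem_bar_homog; case: (Hu g).
have Su g : g \in S -> u g * a g \in CS by move=> Sg;
  apply: (sub_homog gr memCS Sg (Bu g)).
exists (u 1%g), (\sum_(g in S) k g *: (u g * a g)); split.
- by case: (Hu 1%g).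
- by have [_ ->] := Hu 1%g; rewrite (gr_unit1 gr) invr1 r1 mulmx1.
- by apply: memv_suml => g Sg; rewrite memvZ ?Su.
- move=> xi; rewrite linear_sum (lin_sum (@twist_linear xi)) tprod_sumr.
  apply: eq_bigr => g Sg; rewrite linearZ (linZ (@twist_linear xi))
    (twist_homog _ Sg (Bu g)).
  rewrite tprodZr; congr (_ *: tprod _ _).
  have Sa : a g \in CS by apply: (sub_homog gr memCS Sg (gr_unit_mem gr g)).
  have SVa : (a g)^-1 \in CS.
    by apply: (sub_homog gr memCS _ (gr_invr_mem gr g)); rewrite groupV.
  have [Cu ru] := Hu g.
  by rewrite r_mul ?(bar_subset Cu) // ru -mulmxA -r_mul // mulVr
    ?(gr_unit gr) // r1 mulmx1.
rewrite linear_sum (bigD1 1%g) //= big1 ?addr0 => [|g /andP[Sg /negPf g1]].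
  by rewrite linearZ /= (gr_homog gr _ (Bu _)) eqxx (gr_unit1 gr) mulr1.
by rewrite linearZ /= (gr_homog gr _ (Bu _)) eq_sym g1 scaler0.
Qed.

(** The Kronecker products of arbitrary matrices on X with matrix units of one
    xi are reached, and they span. *)
Lemma twist_jointly_onto (N : forall xi : irrS, 'M[K]_(n * irr_degree xi)) :
  exists c, c \in CS /\ forall xi, Y xi (vsproj CS c) = N xi.
Proof.
have one xi : exists c, c \in CS /\
    forall zeta, Y zeta (vsproj CS c) = if zeta == xi then N zeta else 0.
  have kl (p : 'I_(irr_degree xi) * 'I_(irr_degree xi)) : exists c, c \in CS /\
      forall zeta, Y zeta (vsproj CS c) =
        tprod ((slot K n p.1)^T *m N xi *m slot K n p.2)
              (\sum_(g in S) unit_coef p.1 p.2 g *: irr_repr zeta g).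
    have [_ [c [_ _ Cc Yc _]]] := lift_tprod
      ((slot K n p.1)^T *m N xi *m slot K n p.2)
      (unit_coef p.1 p.2).
    by exists c.
  have [c Hc] := choice kl; exists (\sum_p c p).
  split=> [|zeta]; first by apply: memv_suml => p _; case: (Hc p).
  rewrite linear_sum (lin_sum (@twist_linear zeta)).
  have [->|zx] := eqVneq zeta xi.
    rewrite [RHS]tprod_span pair_bigA; apply: eq_bigr => p _.
    by rewrite (Hc p).2 (unit_coef_same splitKS).
  rewrite big1 // => p _.
  by rewrite (Hc p).2 (unit_coef_other splitKS) ?tprod0r // eq_sym.
have [c Hc] := choice one; exists (\sum_xi c xi).
split=> [|xi]; first by apply: memv_suml => zeta _; case: (Hc zeta).
rewrite linear_sum (lin_sum (@twist_linear xi)) (bigD1 xi) //= big1 ?addr0.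
  by rewrite (Hc xi).2 eqxx.
by move=> zeta zx; rewrite (Hc zeta).2 eq_sym (negPf zx).
Qed.

Local Notation inclS := (vsval : subvs_of CS -> B).
Local Notation T xi := (ind_tens inclS (Y xi)).
Local Notation cfS := (@coset_coord K B gT q a S CS).
Local Notation Pi xi := (ind_proj inclS cfS (Y xi)).
Local Notation V xi := (ind_repr inclS (Y xi)).
Local Notation w := (@coset_elt K B gT a S).

Lemma induced_tens_linear xi : linear (T xi).
Proof. exact: ind_tens_linear. Qed.

Lemma induced_tens_sub xi b c :
  c \in CS -> T xi (b * c) = T xi b *m Y xi (vsproj CS c).
Proof. exact: coset_tens_sub. Qed.

Lemma induced_tens_block xi b : T xi (b * e) = T xi b.
Proof.
by rewrite induced_tens_sub ?bar_subset ?bar_block_mem // twist_bar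
  ?bar_block_mem // bar_block_act tprod1 mulmx1.
Qed.

(** Inserting e on the right does not change a tensor, since e acts as 1 on
    X (x) Y. *)
Lemma induced_tens_other xi b y g :
  g \notin S -> y \in Bg g -> T xi (b * e * y) = 0.
Proof.
move=> nSg By; rewrite -induced_tens_block -!mulrA (mulrA e)
  (bar_block_sandwich nSg By) mulr0.
exact: (lin0 (@induced_tens_linear xi)).
Qed.

(** Because e kills every summand except 1 (x) X (x) Y, the element
    w i c e (w j)^-1, with c in KA_S, acts as a matrix whose only nonzero
    block is at (i, j), where it is the action of c on X (x) Y. Choosing c for
    each pair (i, j) reaches every family of matrices. *)
Lemma induced_jointly_onto
  (M : forall xi : irrS, 'M[K]_(\dim (ind_space inclS (Y xi)))) :
  exists b, forall xi, V xi b = M xi.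
Proof.
have cij p := twist_jointly_onto (fun xi => Pi xi p.1 *m M xi *m T xi (w p.2)).
have [c Hc] := choice cij.
exists (\sum_i \sum_j w i * c (i, j) * e * (w j)^-1) => xi.
apply: (coset_ind_ext gr memCS (twist_is_repr xi)) => j.
rewrite ind_repr_tens mulr_suml (lin_sum (@induced_tens_linear xi)).
rewrite -[RHS]mul1mx -(coset_tens_sum gr memCS (twist_is_repr xi)) mulmx_suml.
apply: eq_bigr => i _; rewrite mulr_suml (lin_sum (@induced_tens_linear xi))
  (bigD1 j) //=.
rewrite big1 ?addr0 => [|j' jj].
  rewrite -mulrA mulVr ?(gr_unit gr) // mulr1 induced_tens_block.
  by have [Cc Yc] := Hc (i, j); rewrite induced_tens_sub // Yc /= !mulmxA.
(* The factor (w j')^-1 * w j has degree outside S. *)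
have nS : ((coset_rep j')^-1 * coset_rep j)%g \notin S.
  by rewrite -left_coset_ofE left_coset_of_rep eq_sym.
rewrite -mulrA (induced_tens_other _ _ nS) // (gr_mul gr) ?(gr_invr_mem gr) //.
exact: (gr_unit_mem gr).
Qed.

Lemma induced_is_repr xi : is_repr (V xi).
Proof. exact: (coset_ind_repr gr memCS (twist_is_repr xi)). Qed.

Lemma induced_dim xi :
  \dim (ind_space inclS (Y xi)) = (#|[set: gT] : S|%g * (n * irr_degree xi))%N.
Proof. exact: (coset_ind_dim gr memCS (twist_is_repr xi)). Qed.

Lemma eq_degree_bar : n = nb. Proof. exact: repr_iso_dim extX. Qed.

Lemma induced_dim_gt0 xi : (0 < \dim (ind_space inclS (Y xi)))%N.
Proof.
by rewrite induced_dim !muln_gt0 indexg_gt0 eq_degree_bar nb_gt0 irr_degree_gt0.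
Qed.

Lemma induced_onto xi M : exists b, V xi b = M.
Proof. exact: (jointly_onto_at induced_jointly_onto). Qed.

Lemma induced_irreducible xi : irreducible_repr (V xi).
Proof.
exact: onto_irreducible (induced_is_repr xi) (induced_dim_gt0 xi)
  (@induced_onto xi).
Qed.

Lemma induced_char_distinct xi1 xi2 :
  xi1 <> xi2 -> ~ (repr_char (V xi1) =1 repr_char (V xi2)).
Proof. exact: (jointly_onto_char induced_dim_gt0 induced_jointly_onto). Qed.

Local Notation inclb := (vsval : subvs_of Cb -> B).
Local Notation Tb := (ind_tens inclb Xb).
Local Notation cfb := (@coset_coord K B gT q a [1 gT]%G Cb).
Local Notation Pib := (ind_proj inclb cfb Xb).
Local Notation Vb := (ind_repr inclb Xb).
Local Notation wb := (@coset_elt K B gT a [1 gT]%G).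

Lemma bar_is_repr : is_repr Xb. Proof. by have [] := irrXb. Qed.

(** The maps b (x) x |-> b (x) (x (x) e_i), for xi and i varying, are jointly
    onto because the vectors x (x) e_i for one xi are independent and KA acts
    through all families of matrices. The dimensions agree because the squares
    of the degrees of the xi sum to the order of S. *)
Lemma ind_bar_iso : repr_iso Vb
  (dsum_repr (fun j : {xi : irrS & 'I_(irr_degree xi)} => V (tag j))).
Proof.
have [P [Q [PQ QP rX XbE]]] := X_conj_Xb.
pose L (j : {xi : irrS & 'I_(irr_degree xi)}) :=
  \sum_t T (tag j) (wb t) *m slot K n (tagged j) *m P *m Pib t.
have LT j b : L j *m Tb b = T (tag j) b *m slot K n (tagged j) *m P.
  rewrite [in RHS](coset_coord_sum gr memCb b)
    (lin_sum (@induced_tens_linear _)) !mulmx_suml.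
  apply: eq_bigr => s _.
  rewrite -mulmxA (coset_tens_proj gr memCb bar_is_repr); set c := cfb s b.
  rewrite induced_tens_sub ?(bar_subset (subvsP c)) // twist_bar ?subvsP //
    -(mulmxA _ (tprod _ _)).
  rewrite tprod_slot (bigD1 (tagged j)) //= big1 ?addr0 => [|k /negPf kj].
    by rewrite mxE eqxx scale1r rX -!mulmxA QP mulmx1.
  by rewrite mxE kj scale0r.
apply: (@iso_dsum_surj _ _ _ _ _ _ _ L) => [j b|y|].
- apply: (coset_ind_ext gr memCb bar_is_repr) => s.
  by rewrite -!mulmxA ind_repr_tens !LT !mulmxA ind_repr_tens.
- pose o := Ordinal nb_gt0; pose j1 := left_coset_of S 1%g.
  pose yy xi (i : 'I_(irr_degree xi)) :
    'cV[K]_(\dim (ind_space inclS (Y xi))) :=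
    y (Tagged (fun xi => 'I_(irr_degree xi)) i).
  (* The row multiplied by yy xi i is the linear form with value 1 at the tensor
     of column o of P with the i-th basis vector, and 0 at its tensors with the
     other basis vectors. *)
  pose M xi : 'M[K]_(\dim (ind_space inclS (Y xi))) := \sum_i yy xi i *m
    (delta_mx 0 o *m Q *m (slot K n i)^T *m Pi xi j1).
  have [b Vb] := induced_jointly_onto M.
  exists (Tb (b * w j1) *m delta_mx o 0) => -[xi i].
  rewrite mulmxA LT -ind_repr_tens Vb mulmx_suml mulmx_suml mulmx_suml
    mulmx_suml.
  have E k : delta_mx 0 o *m Q *m (slot K n k)^T *m Pi xi j1 *m T xi (w j1) *m
      slot K n i *m P *m delta_mx o 0 = (k == i)%:R%:M :> 'M_1.
    rewrite -[_ *m Pi _ _ *m _]mulmxA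
      (coset_tens_dual gr memCS (twist_is_repr xi)) eqxx.
    rewrite mulmx1 -[_ *m _^T *m _]mulmxA slot_dual mul_mx_scalar -!scalemxAl.
    rewrite -[_ *m Q *m P]mulmxA QP mulmx1 mul_delta_mx.
    by apply/matrixP => u v; rewrite !ord1 !mxE eqxx mulr1.
  rewrite (bigD1 i) //= big1 ?addr0 => [|k /negPf ki].
    by rewrite -!(mulmxA (yy xi i)) E eqxx mulmx1.
  by rewrite -!(mulmxA (yy xi k)) E ki raddf0 mulmx0.
rewrite (coset_ind_dim gr memCb bar_is_repr) indexg1.
rewrite -(sig_big_dep xpredT (fun _ => xpredT)
  (fun xi _ => \dim (ind_space inclS (Y xi)))) /=.
have E xi : (\sum_(i < irr_degree xi) \dim (ind_space inclS (Y xi)) =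
    #|[set: gT] : S|%g * nb * irr_degree xi ^ 2)%N.
  by rewrite sum_nat_const card_ord induced_dim eq_degree_bar mulnC !mulnA.
rewrite (eq_bigr _ (fun xi _ => E xi)) -big_distrr /= (sum_degree_sq splitKS).
by rewrite [RHS]mulnAC; congr (_ * _)%N; rewrite mulnC Lagrange ?subsetT.
Qed.

Lemma induced_degree xi :
  \dim (ind_space inclS (Y xi)) = (#|[set: gT] : S|%g * nb * irr_degree xi)%N.
Proof. by rewrite induced_dim eq_degree_bar mulnA. Qed.

Lemma ind_bar_char b :
  repr_char Vb b = \sum_(xi : irrS) (irr_degree xi)%:R * repr_char (V xi) b.
Proof.
have [P [Q [_ QP E]]] := repr_iso_conj ind_bar_iso.
rewrite /repr_char E mxtrace_mulC mulmxA QP mul1mx /dsum_repr mxtrace_mxdiag.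
rewrite -(big_enum_val (fun j :
  {xi : irrS & 'I_(irr_degree xi)} => \tr (V (tag j) b))) /=.
rewrite -(sig_big_dep xpredT (fun _ => xpredT) (fun xi _ => \tr (V xi b))) /=.
by apply: eq_bigr => xi _; rewrite sumr_const card_ord mulr_natl.
Qed.

(** The summands w j (x) X (x) Y other than the first are killed because
    e (w j) e = 0. *)
Lemma induced_corner xi c : c \in CS ->
  V xi (c * e) = T xi 1 *m Y xi (vsproj CS c) *m Pi xi (left_coset_of S 1%g).
Proof.
move=> Cc; rewrite -[LHS]mulmx1 -(coset_tens_sum gr memCS (twist_is_repr xi))
  mulmx_sumr.
have w1 : w (left_coset_of S 1%g) = 1.
  by rewrite /coset_elt coset_rep1 (gr_unit1 gr).
rewrite (bigD1 (left_coset_of S 1%g)) //= big1 ?addr0 => [|j j1].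
  by rewrite mulmxA ind_repr_tens w1 mulr1 induced_tens_block
    -[c in T xi c]mul1r induced_tens_sub.
rewrite mulmxA ind_repr_tens (induced_tens_other _ _ _ (gr_unit_mem gr _))
  ?mul0mx //.
by rewrite -[coset_rep j]invgK groupV -[(_^-1)%g]mulg1 -left_coset_ofE eq_sym.
Qed.

Lemma induced_proj_tens1 xi : Pi xi (left_coset_of S 1%g) *m T xi 1 = 1%:M.
Proof.
have := coset_tens_dual gr memCS (twist_is_repr xi) (left_coset_of S 1%g)
  (left_coset_of S 1%g).
by rewrite /coset_elt coset_rep1 (gr_unit1 gr) eqxx.
Qed.

Lemma induced_block_rank xi : \rank (V xi e) = (irr_degree xi * nb)%N.
Proof.
rewrite -[e]mul1r induced_corner ?(sub_one gr memCS) // vsproj_one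
  ?(sub_one gr memCS) //.
have [_ -> _] := twist_is_repr xi.
rewrite (mxrank_conj (induced_proj_tens1 xi) (erefl _)) mxrank1 eq_degree_bar
  mulnC //.
Qed.

Lemma conj_bar_irreducible g : irreducible_repr
  (fun c : subvs_of Cb => Xb (vsproj Cb ((a g)^-1 * vsval c * a g))).
Proof.
have ag := gr_unit gr g; have [lin_X X1 mulX] := bar_is_repr.
apply: onto_irreducible nb_gt0 _ => [|M].
  split=> [k x y||x y].
  - by rewrite linearP mulrDr mulrDl -scalerAr -scalerAl linearP lin_X.
  - have -> : vsval (1 : subvs_of Cb) = 1.
      by apply/eqP; rewrite (algid_eq1 Cb) (sub_one gr memCb).
    by rewrite mulr1 mulVr // vsproj_one ?(sub_one gr memCb).
  - rewrite -mulX -vsproj_mul ?conjV_mem ?subvsP //; congr (Xb (vsproj _ _)).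
    by rewrite /= !mulrA mulrK.
have [c Xc] := irr_onto splitCb irrXb M.
exists (vsproj Cb (a g * vsval c * (a g)^-1)).
rewrite vsprojK ?conj_mem ?subvsP // !mulrA mulVr // mul1r divrK //.
by rewrite vsvalK.
Qed.

(** Every decomposition gives the multiplicity as the rank of e divided by the
    degree of the bar module. One decomposition is by cosets and basis vectors
    of Y: its summands are conjugates of the bar module. *)
Lemma induced_multiplicity xi :
  multiplicity (fun c : subvs_of Cb => V xi (vsval c)) Xb = irr_degree xi.
Proof.
have [P [Q [PQ QP rX XbE]]] := X_conj_Xb.
rewrite /multiplicity; set D := (fun k : nat => _).
have exD : exists k, D k.
  pose J := (coset_index S * 'I_(irr_degree xi))%type.
  pose tau (j : J) (c : subvs_of Cb) := Xb
    (vsproj Cb ((w j.1)^-1 * vsval c * w j.1)).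
  have isoV : repr_iso (fun c : subvs_of Cb => V xi (vsval c)) (dsum_repr tau).
    apply: (@iso_dsum_span _ _ _ _ _ _ _
      (fun j : J => T xi (w j.1) *m slot K n j.2 *m P)
      (fun j : J => Q *m (slot K n j.2)^T *m Pi xi j.1)).
    - move=> -[j i] c /=; rewrite !mulmxA ind_repr_tens /tau /=.
      have wj : w j \is a GRing.unit by apply: (gr_unit gr).
      have Cc := conjV_mem (coset_rep j) (subvsP c).
      have -> : vsval c * w j = w j * ((w j)^-1 * vsval c * w j).
        by rewrite !mulrA divrr // mul1r.
      rewrite induced_tens_sub ?bar_subset // twist_bar //
        -(mulmxA _ (tprod _ _)) tprod_slot.
      rewrite (bigD1 i) //= big1 ?addr0 => [|k /negPf ki].
        rewrite mxE eqxx scale1r -[X in r X](vsprojK Cc) rX -!mulmxA QP mulmx1.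
        by rewrite !mulmxA.
      by rewrite mxE ki scale0r.
    - rewrite -[RHS](coset_tens_sum gr memCS (twist_is_repr xi)).
      rewrite -(pair_bigA _ (fun j i => T xi (w j) *m slot K n i *m P *m
        (Q *m (slot K n i)^T *m Pi xi j))) /=.
      apply: eq_bigr => j _.
      under eq_bigr => i _ do
        rewrite !mulmxA -[_ *m P *m Q]mulmxA PQ mulmx1
          -[_ *m slot K n i *m _]mulmxA.
      by rewrite -mulmx_suml -mulmx_sumr slot_sum mulmx1.
    rewrite induced_degree sum_nat_const card_prod card_ord card_coset_index.
    by rewrite mulnAC.
  exists #|[pred j | `[< repr_iso (tau j) Xb >] ]|, J, (fun=> nb), tau;
    split=> //.
  by move=> j; apply: conj_bar_irreducible.
have [J [d [tau [irr_tau isoV ->]]]] := @classical_sets.xgetPex _ 0%N D exD.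
apply/eqP; rewrite -(eqn_pmul2r nb_gt0) -(induced_block_rank xi).
by rewrite -(multiplicity_rank splitCb irrXb irr_tau isoV).
Qed.

Variable t : B -> K.
Hypothesis symt : symmetrizing_over t.
Hypothesis symtb : symmetrizing_over (fun c : subvs_of Cb => t (vsval c)).
Hypothesis t_homog : forall g x, g != 1%g -> x \in Bg g -> t x = 0.

(** An element that kills all the modules induced from X (x) Y kills the
    module induced from the bar module, since they are its summands. Its
    coordinates on the units a g then kill the bar module, and lie in the
    block of e. *)
Lemma induced_faithful x : x * e = x -> (forall xi, V xi x = 0) -> x = 0.
Proof.
move=> xe Vx; have [lin_Xb _ _] := bar_is_repr.
have Vb0 : Vb x = 0.
  have [P [Q [_ _ ->]]] := repr_iso_conj ind_bar_iso.
  have -> : dsum_repr (fun j : {xi : irrS & 'I_(irr_degree xi)} => V (tag j))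
    x = 0.
    rewrite /dsum_repr; set D := mxdiag _.
    suff -> : D = \mxdiag_k 0 by rewrite mxdiag0.
    by apply: eq_mxdiag => k; rewrite Vx.
  by rewrite mulmx0 mul0mx.
rewrite (coset_coord_sum gr memCb x) big1 // => j _; set c := cfb j x.
suff -> : vsval c = 0 by rewrite mulr0.
have [P [Q [PQ QP rX XbE]]] := X_conj_Xb.
apply: bar_block_faithful; first exact: subvsP.
  by rewrite /c -{2}xe (coset_coord_mul gr memCb).
rewrite rX -(coset_tens_proj gr memCb bar_is_repr) -[x]mulr1 -ind_repr_tens Vb0.
by rewrite mul0mx mulmx0 mulmx0 mul0mx.
Qed.

Lemma bar_scalar_act (x : subvs_of Cb) c (M : subvs_of Cb) :
  Xb x = c%:M -> vsval x * vsval M * e = c *: (vsval M * e).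
Proof.
have [lin_Xb _ mulXb] := bar_is_repr; have [P [Q [PQ QP rX XbE]]] := X_conj_Xb.
move=> Xx; apply/eqP; rewrite -subr_eq0; apply/eqP.
have CM := subvsP M; have Cx := subvsP x.
apply: bar_block_faithful.
- by rewrite rpredB ?memvZ // !(memvM, bar_block_mem).
- by rewrite mulrBl -scalerAl -!mulrA bar_block_idem.
rewrite (linB lin_r) (linZ lin_r) !r_mul ?bar_subset ?memvM ?bar_block_mem //.
by rewrite bar_block_act !mulmx1 (rX x) Xx mul_mx_scalar -scalemxAl PQ
  -scalemxAl mul1mx subrr.
Qed.

(** Take an element c e that acts on the module of xi as a matrix unit and as
    0 on the other modules. The dual element of the character acts on it as
    the scalar s, so s t(c e) is the trace, 1. On the other hand t(c e) only
    sees the degree 1 part of c, which by the choice of the coefficients is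
    xi(1)/|S| times an element u of the base algebra acting as a matrix unit;
    and t(u e) is inverse to the Schur element of the bar module. *)
Lemma induced_schur_element xi : schur_element t (V xi) =
  #|S|%:R / (irr_degree xi)%:R * schur_element
    (fun c : subvs_of Cb => t (vsval c)) Xb.
Proof.
have [lin_t tC _] := symt; have [P [Q [PQ QP rX XbE]]] := X_conj_Xb.
have n_gt0 : (0 < n)%N by rewrite eq_degree_bar.
pose o := Ordinal n_gt0; pose o' := Ordinal (irr_degree_gt0 xi).
have [u [c [Cu ru Cc Yc qc]]] := lift_tprod (delta_mx o o) (unit_coef o' o').
have [lin_V _ mulV] := induced_is_repr xi.
have [tv Vv] := schur_elementP symt (induced_dim_gt0 xi) (induced_is_repr xi)
  (@induced_onto xi).
have [tvb Xvb] := schur_elementP symtb nb_gt0 bar_is_repr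
  (irr_onto splitCb irrXb).
set v := dual_element _ _ in tv Vv; set s := schur_element _ _ in Vv *.
set vb := dual_element _ _ in tvb Xvb; set sb := schur_element _ _ in Xvb *.
have Cue : u * e \in Cb by rewrite memvM ?bar_block_mem.
(* On KA e the element v acts as its scalar on the module of xi. *)
have vce : v * (c * e) = s *: (c * e).
  apply/eqP; rewrite -subr_eq0; apply/eqP/induced_faithful => [|zeta].
    by rewrite mulrBl -scalerAl -!mulrA bar_block_idem.
  have [lin_z _ mulz] := induced_is_repr zeta.
  rewrite (linB lin_z) (linZ lin_z) mulz.
  have [->|zx] := eqVneq zeta xi; first by rewrite Vv mul_scalar_mx subrr.
  rewrite induced_corner // Yc (unit_coef_other splitKS) 1?eq_sym // tprod0r.
  by rewrite mulmx0 mul0mx mulmx0 scaler0 subrr.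
have tbe : sb * t (u * e) = 1.
  have := tvb (vsproj Cb (u * e));
    rewrite XbE vsprojK // r_mul ?bar_subset ?bar_block_mem //.
  rewrite bar_block_act mulmx1 ru mxtrace_mulC mulmxA PQ mul1mx trace_delta
    eqxx => E1.
  have := bar_scalar_act (vsproj Cb u) Xvb; rewrite vsprojK //= => E.
  by rewrite -[RHS]/(true%:R) -E1 /= vsprojK // mulrA E (linZ lin_t).
have tce : t (c * e) = (irr_degree xi)%:R / #|S|%:R * t (u * e).
  rewrite {1}(gr_sum gr (c * e)) (lin_sum lin_t) (bigD1 1%g) //= big1 ?addr0.
    rewrite (gr_mulr gr _ _ ((mem_bar_homog e).1 bar_block_mem)).
    by rewrite invg1 mulg1 qc -scalerAl (linZ lin_t) unit_coef1.
  by move=> g g1; apply: (t_homog g1 (gr_mem gr g _)).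
have chi1 : s * t (c * e) = 1.
  have <- : t (v * (c * e)) = s * t (c * e) by rewrite vce (linZ lin_t).
  rewrite tv induced_corner // mxtrace_mulC mulmxA induced_proj_tens1 mul1mx Yc
    (unit_coef_same splitKS).
  by rewrite mxtrace_prod !trace_delta !eqxx mulr1.
have nz := irr_degree_neq0 splitKS xi; have Snz := card_group_neq0 splitKS.
have tnz : t (u * e) != 0.
  by apply: contra_eq_neq tbe => ->; rewrite mulr0 eq_sym oner_neq0.
apply: (mulIf tnz); rewrite -[RHS]mulrA tbe mulr1.
apply: (mulfI (mulf_neq0 nz (invr_neq0 Snz))).
rewrite mulrCA -tce chi1 mulf_div [_ * _%:R in X in _ / X]mulrC divff //.
by rewrite mulf_neq0.
Qed.

End CliffordCorrespondence.

(** * Scalar extension of an algebra with a symmetrizing form *)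

Section ScalarExtension.

Variables (O : idomainType) (K : fieldType) (phi : {rmorphism O -> K}).
Variable A : falgType O.
Local Notation KA := (scext phi A).
Local Notation iota := (@scext_inj O K phi A).

Lemma iotaD x y : iota (x + y) = iota x + iota y.
Proof. by rewrite /scext_inj linearD map_mxD. Qed.

Lemma iota0 : iota 0 = 0.
Proof. by rewrite /scext_inj linear0 map_mx0. Qed.

Lemma iotaZ k x : iota (k *: x) = phi k *: iota x.
Proof. by rewrite /scext_inj linearZ map_mxZ. Qed.

Lemma iota_sum (I : Type) (r : seq I) (P : pred I) F :
  iota (\sum_(i <- r | P i) F i) = \sum_(i <- r | P i) iota (F i).
Proof. exact: (big_morph _ iotaD iota0). Qed.

Lemma iotaM x y : iota (x * y) = iota x * iota y.
Proof. exact: scext_injM. Qed.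

Lemma iota1 : iota 1 = 1. Proof. by []. Qed.

Lemma span_mem (P : A -> Prop) x : P x -> iota x \in scext_span phi P.
Proof. by move=> Px; apply: (vspanP _).1; exists x. Qed.

Lemma span_sub (P : A -> Prop) (W : {vspace KA}) :
  (forall x, P x -> iota x \in W) -> (scext_span phi P <= W)%VS.
Proof. by move=> PW; apply: (vspanP _).2 => _ [x Px ->]; apply: PW. Qed.

Lemma span_eq (P : A -> Prop) (vT : vectType K) (f g : {linear KA -> vT}) :
  (forall x, P x -> f (iota x) = g (iota x)) ->
  forall u, u \in scext_span phi P -> f u = g u.
Proof.
move=> eqfg u Pu.
suff /subvP/(_ u Pu) : (scext_span phi P <= lker (linfun f - linfun g))%VS.
  by rewrite memv_ker !lfunE /= opp_lfunE !lfunE subr_eq0 => /eqP.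
apply: span_sub => x /eqfg E.
by rewrite memv_ker !lfunE /= opp_lfunE !lfunE subr_eq0 E.
Qed.

Lemma span_full (P : A -> Prop) : (forall x, P x) -> scext_span phi P = fullv.
Proof.
move=> PT; apply/eqP; rewrite eqEsubv subvf; apply/subvP => u _.
by rewrite [u]scext_sum; apply: memv_suml => i _; rewrite memvZ // span_mem.
Qed.

(** The K-linear extension of an O-linear map. *)
Definition scext_map (p : A -> A) (u : KA) : KA :=
  \sum_i u 0 i *: iota (p (scext_basis i)).

Lemma scext_map_is_linear p : linear (scext_map p).
Proof.
move=> k u v; rewrite /scext_map scaler_sumr -big_split; apply: eq_bigr => i _.
by rewrite !mxE scalerDl scalerA.
Qed.

HB.instance Definition _ p :=
  GRing.isLinear.Build K KA KA _ (scext_map p) (scext_map_is_linear p).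

Lemma scext_map_iota p x : linear p -> scext_map p (iota x) = iota (p x).
Proof.
move=> lin_p; rewrite {2}[x]scext_basis_sum (lin_sum lin_p) iota_sum.
by apply: eq_bigr => i _; rewrite (linZ lin_p) iotaZ mxE.
Qed.

Lemma scext_form_is_linear (t : A -> O) : linear (scext_form phi t : KA -> K^o).
Proof.
move=> k u v; rewrite /scext_form scaler_sumr -big_split; apply: eq_bigr => i _.
by rewrite !mxE mulrDl -mulrA.
Qed.

Variable t : {scalar A}.
Local Notation tK := (scext_form phi t : KA -> K^o).

HB.instance Definition _ :=
  GRing.isLinear.Build K KA K^o _ tK (scext_form_is_linear t).

Lemma scext_form_iota x : scext_form phi t (iota x) = phi (t x).
Proof.
rewrite {2}[x]scext_basis_sum linear_sum rmorph_sum; apply: eq_bigr => i _.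
by rewrite linearZ /= rmorphM mxE.
Qed.

(** The coordinates of a free module are linear forms, so the symmetrizing
    property represents each of them by some d i. *)
Lemma symmetrizing_dual_basis (P : A -> Prop) :
    submodule P -> free_finite_rank P -> symmetrizing_form P t ->
  exists n (b d : 'I_n -> A), [/\ forall i, P (b i), forall i, P (d i) &
    forall x, P x -> x = \sum_i t (d i * x) *: b i].
Proof.
move=> [P0 PL] [n [b [Pb freeb]]] [_ perf].
have coord x : exists c : {ffun 'I_n -> O}, P x -> x = \sum_i c i *: b i.
  have [/freeb[c [Ec _]]|nPx] := pselect (P x); first by exists c.
  by exists [ffun=> 0].
have [c Hc] := choice coord.
(* Outside P the coordinates c are arbitrary, so they are linear on P only. *)
have lin_c i k x y : P x -> P y -> c (k *: x + y) i = k * c x i + c y i.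
  move=> Px Py; have Pxy := PL k _ _ Px Py.
  have [c0 [_ uc]] := freeb _ Pxy.
  rewrite -(uc _ (Hc _ Pxy)) (uc [ffun i => k * c x i + c y i]) ?ffunE //.
  rewrite {1}(Hc x Px) {1}(Hc y Py) scaler_sumr -big_split;
    apply: eq_bigr => j _.
  by rewrite ffunE scalerDl scalerA.
have dual i : exists d, P d /\ forall x, P x -> c x i = t (d * x).
  by have [d [Hd _]] := perf (c^~ i) (lin_c i); exists d.
have [d Hd] := choice dual; exists n, b, d; split=> // [i|x Px].
  by case: (Hd i).
by rewrite {1}(Hc x Px); apply: eq_bigr => i _; rewrite (Hd i).2.
Qed.

Lemma span_dual_basis (P : A -> Prop) n (b d : 'I_n -> A) :
  (forall x, P x -> x = \sum_i t (d i * x) *: b i) ->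
  forall u, u \in scext_span phi P -> u =
    \sum_i tK (iota (d i) * u) *: iota (b i).
Proof.
move=> dual; pose f (u : KA) : KA := \sum_i tK (iota (d i) * u) *: iota (b i).
have lin_f : linear f.
  move=> k u v; rewrite /f scaler_sumr -big_split; apply: eq_bigr => i _.
  by rewrite mulrDr -scalerAr linearP scalerDl scalerA.
pose F := GRing.isLinear.Build K KA KA _ f lin_f.
pose fL : {linear KA -> KA} := HB.pack f F.
apply: (@span_eq P _ idfun fL) => x Px /=.
rewrite {1}(dual x Px) iota_sum; apply: eq_bigr => i _.
by rewrite iotaZ -iotaM scext_form_iota.
Qed.

Hypothesis tC : forall x y, t (x * y) = t (y * x).

Lemma scext_formC u v : tK (u * v) = tK (v * u).
Proof.
rewrite [u]scext_sum mulr_suml mulr_sumr !linear_sum; apply: eq_bigr => i _ /=.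
rewrite -scalerAl -scalerAr !linearZ /=; congr (_ *: _).
rewrite [v]scext_sum mulr_suml mulr_sumr !linear_sum; apply: eq_bigr => j _ /=.
rewrite -scalerAl -scalerAr !linearZ /=; congr (_ *: _).
by rewrite -!iotaM !scext_form_iota tC.
Qed.

Lemma free_finite_rankT : free_finite_rank (fun _ : A => True).
Proof.
exists (dim A), (@scext_basis O A); split=> // x _.
exists [ffun i => v2r x 0 i]; split=> [|c Ec].
  by rewrite {1}[x]scext_basis_sum; apply: eq_bigr => i _; rewrite ffunE.
apply/ffunP => i; rewrite ffunE Ec linear_sum summxE (bigD1 i) //= big1.
  by rewrite linearZ /= r2vK !mxE !eqxx mulr1 addr0.
by move=> j ji; rewrite linearZ /= r2vK !mxE [i == j]eq_sym (negPf ji) mulr0.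
Qed.

Lemma scext_symmetrizing :
  symmetrizing_form (fun _ : A => True) t ->
    symmetrizing_over (scext_form phi t : KA -> K).
Proof.
move=> symt; split; [exact: scext_form_is_linear | exact: scext_formC |].
have subT : submodule (fun _ : A => True) by [].
have [n [b [d [_ _ dual]]]] := symmetrizing_dual_basis subT free_finite_rankT
  symt.
exists 'I_n, (fun i => iota (b i)), (fun i => iota (d i)) => u.
by apply: (span_dual_basis dual); rewrite span_full ?memvf.
Qed.

Lemma scext_sub_symmetrizing (P : A -> Prop) :
    subalgebra P -> free_finite_rank P -> symmetrizing_form P t ->
  symmetrizing_over (fun c : subvs_of (scext_sub phi P) =>
    scext_form phi t (vsval c)).
Proof.
move=> algP freeP symP; have [subP _ _] := algP.
have spanE := scext_subE phi algP.
split=> [k x y|x y|]; [exact: scext_form_is_linear | exact: scext_formC |].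
have [n [b [d [Pb Pd dual]]]] := symmetrizing_dual_basis subP freeP symP.
exists 'I_n, (fun i => vsproj _ (iota (b i))),
  (fun i => vsproj _ (iota (d i))) => u.
have Cb i : iota (b i) \in scext_sub phi P by rewrite spanE span_mem.
have Cd i : iota (d i) \in scext_sub phi P by rewrite spanE span_mem.
apply: val_inj; rewrite /= linear_sum /=.
rewrite {1}(span_dual_basis dual (u := vsval u)); last by rewrite -spanE subvsP.
by apply: eq_bigr => i _; rewrite !vsprojK.
Qed.

End ScalarExtension.

(** * Scalar extension of the grading *)

Section ScalarExtensionGrading.

Variables (O : idomainType) (K : fieldType) (phi : {rmorphism O -> K}).
Variables (A : falgType O) (t : {scalar A}).
Variables (gT : finGroupType) (Abar : A -> Prop) (A_ : gT -> A -> Prop).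
Hypothesis twA : twisted_symmetric_algebra t Abar A_.
Variable a : gT -> A.
Hypothesis unita : graded_units Abar A_ a.

Local Notation KA := (scext phi A).
Local Notation iota := (@scext_inj O K phi A).
Local Notation Bg := (fun g => scext_span phi (A_ g)).
Local Notation q := (graded_proj phi A_).

Lemma comp0 g : A_ g 0.
Proof. by case: (tsa_submodule twA g). Qed.

Lemma comp_mul g h x y : A_ g x -> A_ h y -> A_ (g * h)%g (x * y).
Proof.
move=> Ax Ay; apply/(tsa_mul twA g h); exists 1%N, (fun=> x), (fun=> y).
by split=> //; rewrite big_ord1.
Qed.

Lemma comp_sum (S : {group gT}) g (x : gT -> A) :
  (forall h, A_ g (x h)) -> A_ g (\sum_(h in S) x h).
Proof.
move=> Ax; have [A0 AL] := tsa_submodule twA g.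
elim/big_rec: _ => // h y _ Ay.
by rewrite -[x h]scale1r; apply: AL.
Qed.

Lemma component_exists : exists p : gT -> A -> A,
  [/\ forall g, linear (p g), forall g x, A_ g (p g x),
      forall x, x = \sum_g p g x &
      forall g h x, A_ h x -> p g x = if g == h then x else 0].
Proof.
have [c Hc] := choice (tsa_direct twA).
have unic x c' :
    (forall g, A_ g (c' g)) -> x = \sum_g c' g -> forall g, c x g = c' g.
  move=> Ac' Ex g; rewrite ((Hc x).2 [ffun g => c' g]) ?ffunE //; split=> [h|].
    by rewrite ffunE.
  by rewrite Ex; apply: eq_bigr => h _; rewrite ffunE.
exists (fun g x => c x g); split.
- move=> g k x y; have [[Ax Ex] _] := Hc x; have [[Ay Ey] _] := Hc y.
  apply: (unic _ (fun g => k *: c x g + c y g)) => [h|].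
    by case: (tsa_submodule twA h) => _; apply.
  by rewrite {1}Ex {1}Ey scaler_sumr big_split.
- by move=> g x; case: (Hc x) => [[]].
- by move=> x; case: (Hc x) => [[]].
move=> g h x Ax; apply: (unic _ (fun g => if g == h then x else 0)) => [k|].
  by case: eqP => [->|_] //; apply: comp0.
by rewrite -big_mkcond big_pred1_eq.
Qed.

Lemma graded_proj_mem g u : q g u \in scext_span phi (A_ g).
Proof. exact: memv_sum_pi. Qed.

Lemma span_comp_sum : (\sum_(g : gT) scext_span phi (A_ g))%VS = fullv.
Proof.
have [p [lin_p Ap sum_p _]] := component_exists.
apply/eqP; rewrite eqEsubv subvf; apply/subvP => u _.
rewrite [u]scext_sum; apply: memv_suml => i _; rewrite memvZ //.
rewrite [scext_basis i]sum_p iota_sum; apply: memv_suml => g _.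
by apply: (subvP (sumv_sup g _ (subvv _))) => //; apply: span_mem.
Qed.

Lemma graded_proj_sum u : u = \sum_g q g u.
Proof. by rewrite /graded_proj sumv_pi_sum // span_comp_sum memvf. Qed.

(** The components over O are the images of O-linear projections, whose scalar
    extensions show that the spans of the components are independent. *)
Lemma graded_proj_homog g h u :
  u \in scext_span phi (A_ h) -> q g u = if g == h then u else 0.
Proof.
have [p [lin_p Ap _ homog_p]] := component_exists.
have pE k l v : v \in scext_span phi (A_ l) ->
    scext_map (p k) v = if k == l then v else 0.
  move=> Bv; have [kl|kl] := eqVneq k l.
    apply: (@span_eq _ _ phi _ (A_ l) _ (scext_map (p k)) idfun) Bv => x Ax.
    by rewrite /= scext_map_iota // (homog_p _ l) // kl eqxx.
  apply: (@span_eq _ _ phi _ (A_ l) _ (scext_map (p k)) \0) Bv => x Ax.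
  by rewrite /= scext_map_iota // (homog_p _ l) // (negPf kl) iota0.
move=> Bu; rewrite -pE // [in RHS](graded_proj_sum u) linear_sum (bigD1 g) //=.
rewrite (pE _ _ _ (graded_proj_mem g u)) eqxx big1 ?addr0 // => k /negPf kg.
by rewrite (pE _ _ _ (graded_proj_mem k u)) eq_sym kg.
Qed.

Lemma span_comp_mul g h u v : u \in scext_span phi (A_ g) ->
  v \in scext_span phi (A_ h) -> u * v \in scext_span phi (A_ (g * h)%g).
Proof.
move=> Bu Bv; suff /subvP/(_ u Bu) : (scext_span phi (A_ g) <=
    amulr v @^-1: scext_span phi (A_ (g * h)%g))%VS.
  by rewrite -memv_preim lfunE.
apply: span_sub => x Ax; rewrite -memv_preim lfunE /=.
suff /subvP/(_ v Bv) : (scext_span phi (A_ h) <=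
    amull (iota x) @^-1: scext_span phi (A_ (g * h)%g))%VS.
  by rewrite -memv_preim lfunE.
apply: span_sub => y Ay; rewrite -memv_preim lfunE /=.
by rewrite -iotaM span_mem //; apply: comp_mul.
Qed.

Lemma scext_graded : graded_by_units Bg q (fun g => iota (a g)).
Proof.
have [a1 unita'] := unita; split.
- exact: graded_proj_mem.
- exact: graded_proj_sum.
- exact: graded_proj_homog.
- exact: span_comp_mul.
- by move=> g; apply: span_mem; case: (unita' g).
- move=> g; case: (unita' g) => ag _ _ _; apply/unitrP; exists (iota (a g)^-1).
  by rewrite -!iotaM mulVr ?divrr // iota1.
by rewrite a1 iota1.
Qed.

Lemma Abar_subalgebra : subalgebra Abar.
Proof. by case: (tsa_symmetric twA). Qed.

Lemma mem_scext_sub_bar u : u \in scext_sub phi Abar <->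
  (forall g, g \notin [1 gT]%G -> q g u = 0).
Proof.
rewrite (scext_subE phi Abar_subalgebra).
have -> : (u \in scext_span phi Abar) = (u \in scext_span phi (A_ 1%g)).
  by apply/idP/idP; apply/subvP/span_sub => x /(tsa_one twA); apply: span_mem.
split=> [Bu g|u1]; first by rewrite inE (graded_proj_homog g Bu) => /negPf ->.
rewrite (graded_proj_sum u) (bigD1 1%g) //= big1 ?addr0 ?graded_proj_mem // =>
  g g1.
by rewrite u1 // inE.
Qed.

Lemma sub_sum_subalgebra (S : {group gT}) : subalgebra (sub_sum A_ S).
Proof.
split.
- split=> [|k x y [c Ac ->] [c' Ac' ->]].
    exists (fun=> 0); first exact: comp0.
    by rewrite big1.
  exists (fun g => k *: c g + c' g) => [g|];
    last by rewrite scaler_sumr -big_split.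
  by case: (tsa_submodule twA g) => _; apply.
- exists (fun g => if g == 1%g then 1 else 0) => [g|].
    case: eqP => [->|_]; last exact: comp0.
    by apply/(tsa_one twA); case: Abar_subalgebra.
  by rewrite (bigD1 1%g) //= eqxx big1 ?addr0 // => g /andP[_ /negPf ->].
move=> x y [c Ac ->] [c' Ac' ->].
exists (fun k => \sum_(g in S) c g * c' (g^-1 * k)%g) => [k|].
  apply: comp_sum => g; rewrite -[k in A_ k](mulKVg g); exact: comp_mul.
rewrite mulr_suml exchange_big; apply: eq_bigr => g Sg.
rewrite mulr_sumr [RHS](reindex_inj (mulgI g)) /=.
by apply: eq_big => [h|h _]; rewrite ?groupMl // mulKg.
Qed.

Lemma mem_scext_sub_sum (S : {group gT}) u :
  u \in scext_sub phi (sub_sum A_ S) <->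
  (forall g, g \notin S -> q g u = 0).
Proof.
rewrite (scext_subE phi (sub_sum_subalgebra S)); split=> [Bu g nSg|u0].
  apply: (@span_eq _ _ phi _ (sub_sum A_ S) _ (q g) \0) Bu => x [c Ac ->].
  rewrite /= iota_sum linear_sum big1 // => h Sh.
  rewrite /= (graded_proj_homog g (span_mem phi (Ac h))).
  by case: eqP nSg => // ->; rewrite Sh.
rewrite (graded_proj_sum u) (bigID [in S]) /= [X in _ + X]big1 ?addr0 //.
apply: memv_suml => g Sg.
apply: (subvP (span_sub _)) (graded_proj_mem g u) => x Ax; apply: span_mem.
exists (fun h => if h == g then x else 0) => [h|].
  by case: eqP => [->|_] //; apply: comp0.
by rewrite (bigD1 g) //= eqxx big1 ?addr0 // => h /andP[_ /negPf ->].
Qed.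

Lemma scext_form_homog g u :
  g != 1%g -> u \in scext_span phi (A_ g) -> scext_form phi t u = 0.
Proof.
move=> g1;
  apply: (@span_eq _ _ phi _ (A_ g) _ (scext_form phi t : KA -> K^o) \0) =>
    x Ax.
by rewrite /= scext_form_iota (tsa_form twA g1 Ax) rmorph0.
Qed.

End ScalarExtensionGrading.

Theorem proposition2p3p14
  (O : idomainType) (noethO : noetherian O) (closedO : integrally_closed O)
  (K : splittingFieldType {fraction O}) (galK : galois 1%VS {:K}%VS)
  (A : falgType O) (t : {scalar A})
  (symt : symmetrizing_form (fun _ => True) t)
  (gT : finGroupType) (Abar : A -> Prop) (A_ : gT -> A -> Prop)
  (twA : twisted_symmetric_algebra t Abar A_)
  (a : gT -> A) (unita : graded_units Abar A_ a)
  (splitKA : split_semisimple (scalar_ext K A))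
  (splitKAbar : split_semisimple (scalar_ext_sub K Abar))
  (nbar : nat) (Xbar : scalar_ext_sub K Abar -> 'M[K]_nbar)
  (irrXbar : irreducible_repr Xbar)
  (S : {group gT}) (stabS : S = char_stab a Xbar :> {set gT})
  (splitKS : group_split_semisimple K S)
  (n : nat) (X : scalar_ext_sub K (sub_sum A_ S) -> 'M[K]_n)
  (irrX : irreducible_repr X)
  (extX : repr_iso
     (res_repr (scext_sub_incl (frac_emb K) Abar (sub_sum A_ S)) X) Xbar)
  (irrS : irrType K S) :
  let inclS : scalar_ext_sub K (sub_sum A_ S) -> scalar_ext K A := vsval in
  let inclbar : scalar_ext_sub K Abar -> scalar_ext K A := vsval in
  let X_ (xi : irrS) := ind_repr inclS (tens_repr X (irr_repr xi)) in
  let Indbar := ind_repr inclbar Xbar in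
  [/\ (forall xi, irreducible_repr (X_ xi)) /\
      (forall xi1 xi2, xi1 <> xi2 ->
         ~ (repr_char (X_ xi1) =1 repr_char (X_ xi2))),
      [/\ repr_iso Indbar
            (dsum_repr (fun j : {xi : irrS & 'I_(irr_degree xi)} => X_ (tag j))),
          forall b, repr_char Indbar b =
            \sum_(xi : irrS) (irr_degree xi)%:R * repr_char (X_ xi) b,
          forall xi, multiplicity (res_repr inclbar (X_ xi)) Xbar = irr_degree xi &
          forall xi, repr_degree (X_ xi) =
            (#|[set: gT] : S|%g * repr_degree Xbar * irr_degree xi)%N] &
      forall xi, schur_element (scext_form (frac_emb K) t) (X_ xi) =
        #|S|%:R / (irr_degree xi)%:R *
          schur_element (scext_sub_form (frac_emb K) Abar t) Xbar].
Proof.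
move=> inclS inclbar X_ Indbar.
have gr := scext_graded (frac_emb K) twA unita.
have memCb := mem_scext_sub_bar (phi := frac_emb K) twA.
have memCS := mem_scext_sub_sum (phi := frac_emb K) twA S.
have stab g : (g \in S) = (scext_inj (frac_emb K) (a g) *
    vsval (block_idempotent Xbar) * (scext_inj (frac_emb K) (a g))^-1
    == vsval (block_idempotent Xbar))
      by rewrite -[g \in S]/(g \in (S : {set gT})) stabS inE.
have [reprX _ _] := irrX.
pose Y (xi : irrS) := tens_repr X (irr_repr xi).
have YE xi x : Y xi x = \sum_(g in S) tprod (X (vsproj _
    (graded_proj (frac_emb K) A_ g (vsval x)))) (irr_repr xi g) by [].
have [[symbar freebar symtbar _] [tC _]] := (tsa_symmetric twA, symt).
have symtK := scext_symmetrizing (frac_emb K) (fun x y => tC x y I I) symt.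
have symtKb := scext_sub_symmetrizing (frac_emb K) (fun x y => tC x y I I)
  symbar freebar symtbar.
split; [split | split |].
- exact: (induced_irreducible gr memCb splitKAbar irrXbar memCS stab reprX extX
    splitKS YE).
- exact: (induced_char_distinct gr memCb splitKAbar irrXbar memCS stab reprX
    extX splitKS YE).
- exact: (ind_bar_iso gr memCb splitKAbar irrXbar memCS stab reprX extX splitKS
    YE).
- exact: (ind_bar_char gr memCb splitKAbar irrXbar memCS stab reprX extX splitKS
    YE).
- exact: (induced_multiplicity gr memCb splitKAbar irrXbar memCS stab reprX extX
    YE).
- exact: (induced_degree gr memCb memCS reprX extX YE).
exact: (induced_schur_element gr memCb splitKAbar irrXbar memCS stab reprX extX
  splitKS YE
  symtK symtKb (scext_form_homog twA)).
Qed.
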